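(* Let $T>0$, let $u_0$ be an admissible initial value, and let $M_0=\int_\Omega u_0(\mathbf{x})\,\mathrm{d}\mathbf{x}$. Suppose that $\kappa\ge \max_{|\xi|\le 1}(|f'(\xi)|+|g'(\xi)|)=4$ and $\|u_0\|\le 1$ with $|M_0|\neq|\Omega|$. Assume that the exact solution $u$ of the mass-conserving Allen-Cahn problem belongs to $C^1([0,T];C(\overline\Omega))$, let $\gamma_u>0$ be a constant such that $\int_\Omega g(u(\mathbf{x},t))\,\mathrm{d}\mathbf{x}\ge\gamma_u$ for all $t\in[0,T]$, and let $\{u^n\in C(\overline\Omega)\}_{n\ge0}$ be the approximate solution generated by the ETD1 scheme with time step $\tau$. Assume furthermore that there exists a constant $\gamma_d>0$ such that $\int_\Omega g(u^n(\mathbf{x}))\,\mathrm{d}\mathbf{x}\ge\gamma_d$ for any $n$ with $n\tau\le T$, and define $\gamma=\min(\gamma_u,\gamma_d)$. Then, for any $\tau>0$, with $t_n=n\tau$, $$\|u(t_n)-u^n\|\le \frac{C^*_\gamma}{C^*_\gamma-1}\,C\,e^{(C^*_\gamma-1)\kappa t_n}\,\tau,\qquad \forall\, t_n\le T,$$ where the constant $C>0$ is independent of $\tau$, $\gamma$ and $\kappa$, and $$C^*_\gamma=\frac32+\frac{C_\gamma}{4},\qquad C_\gamma=\frac{4|\Omega|}{\gamma}+\frac{2|\Omega|^2}{\gamma^2}.$$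
   Context: Let $\Omega\subset\mathbb{R}^d$ ($d=2,3$) be open, connected and bounded with Lipschitz boundary, $\varepsilon>0$, and let $\|\cdot\|$ be the supremum norm on $C(\overline\Omega)$. Boundary conditions: either homogeneous Neumann ($\partial u/\partial\mathbf{n}=0$ on $\partial\Omega$), or periodic, in which case $\Omega=\prod_{i=1}^d(a_i,b_i)$ and all functions, including $u_0$, are periodic. An admissible initial value is $u_0\in C(\overline\Omega)$ (periodic in the periodic case). Put $f(s)=s-s^3$, $g(s)=1-s^2$, and for $\xi\in C(\overline\Omega)$ with $\int_\Omega g(\xi)\,\mathrm{d}\mathbf{x}\ne0$, $$\lambda_\xi=\frac{\int_\Omega f(\xi(\mathbf{x}))\,\mathrm{d}\mathbf{x}}{\int_\Omega g(\xi(\mathbf{x}))\,\mathrm{d}\mathbf{x}},\qquad \mathcal{N}[\xi]=\kappa\xi+f(\xi)-\lambda_\xi\, g(\xi).$$ The mass-conserving Allen-Cahn problem is $$\partial_t u=\varepsilon^2\Delta u+f(u)-\lambda_{u(\cdot,t)}\,g(u)\ \text{ in }\Omega,\ t>0,\qquad u(\cdot,0)=u_0,$$ with the chosen boundary condition; equivalently $\partial_t u=\mathcal{L}_\kappa u+\mathcal{N}[u]$ with $\mathcal{L}_\kappa=\varepsilon^2\Delta-\kappa\mathcal{I}$. It conserves mass, $\int_\Omega u(\mathbf{x},t)\,\mathrm{d}\mathbf{x}=M_0$, and it is known (Alfaro–Alifrangis) that $\|u_0\|\le1$ implies $\|u(t)\|\le 1$ for all $t\ge0$. When $|M_0|\ne|\Omega|$,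 a constant $\gamma_u$ as in the claim always exists, by continuity of $u$. Here $\Delta$ is the Laplacian with the chosen boundary condition; $\{e^{t\Delta}\}_{t\ge0}$ is the contraction semigroup it generates with respect to the supremum norm (on $C(\overline\Omega)$, or its subspace of periodic functions in the periodic case), and $e^{t\mathcal{L}_\kappa}=e^{-\kappa t}e^{t\varepsilon^2\Delta}$. ETD1 scheme with step $\tau>0$: $u^0=u_0$, and for $n\ge 0$, $u^{n+1}=w^n(\tau)$, where $w^n$ solves $\partial_s w^n=\mathcal{L}_\kappa w^n+\mathcal{N}[u^n]$ in $\Omega$ for $s\in(0,\tau]$, $w^n(\cdot,0)=u^n$, with the chosen boundary condition; equivalently $$u^{n+1}=e^{\tau\mathcal{L}_\kappa}u^n+\int_0^\tau e^{(\tau-s)\mathcal{L}_\kappa}\mathcal{N}[u^n]\,\mathrm{d}s.$$ *)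

(* Defs.v *)
From HB Require Import structures.
From mathcomp Require Import all_boot all_order all_algebra.
From mathcomp Require Import all_classical all_reals all_analysis.
From mathcomp Require Import ring lra.

Set Implicit Arguments.
Unset Strict Implicit.
Unset Printing Implicit Defensive.
Import Order.TTheory GRing.Theory Num.Theory.
Import numFieldNormedType.Exports.
Local Open Scope classical_set_scope.
Local Open Scope ring_scope.

Definition measure_rV_display : measure_display.
Proof. exact. Qed.

(* R^n carries the sigma-algebra generated by its coordinates, as the library
   does for tuples; it is the Borel sigma-algebra. *)
Section measurable_rV.
Variables (R : realType) (n : nat).

Let coors : 'I_n -> 'rV[R]_n -> R := fun i x => x ord0 i.

Let rV_set0 : g_sigma_preimage coors set0.
Proof. exact: sigma_algebra0. Qed.

Let rV_setC A : g_sigma_preimage coors A -> g_sigma_preimage coors (~` A).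
Proof. exact: sigma_algebraC. Qed.

Let rV_bigcup (F : _^nat) : (forall i, g_sigma_preimage coors (F i)) ->
  g_sigma_preimage coors (\bigcup_i (F i)).
Proof. exact: sigma_algebra_bigcup. Qed.

HB.instance Definition _ := @isMeasurable.Build measure_rV_display
  'rV[R]_n (g_sigma_preimage coors) rV_set0 rV_setC rV_bigcup.

Lemma measurable_coord (i : 'I_n) :
  measurable_fun [set: 'rV[R]_n] (fun x : 'rV[R]_n => x ord0 i).
Proof.
move=> _ Y mY; rewrite setTI; apply: sub_sigma_algebra => /=.
rewrite -bigcup_seq/=; exists i => /=; first by rewrite mem_index_enum.
by exists Y => //; rewrite setTI.
Qed.

Lemma measurable_fun_rV d (T : measurableType d) (f : T -> 'rV[R]_n) :
  (forall i, measurable_fun [set: T] (fun x => f x ord0 i)) ->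
  measurable_fun [set: T] f.
Proof.
move=> mf.
suff : measurable `<=` [set B | measurable (f @^-1` B)].
  by move=> H _ B mB; rewrite setTI; exact: H.
apply: smallest_sub; first split => /=.
- by rewrite preimage_set0.
- by move=> B mB; rewrite setTD preimage_setC; exact: measurableC.
- by move=> F mF; rewrite preimage_bigcup; exact: bigcup_measurable.
- rewrite -bigcup_seq => B [i _ [C mC <-]] /=.
  by rewrite setTI -comp_preimage -[X in measurable X]setTI; exact: mf.
Qed.

End measurable_rV.

Section lebesgue_rV.
Variable R : realType.

Definition rV_cons n (p : R * 'rV[R]_n) : 'rV[R]_n.+1 :=
  row_mx (p.1)%:M p.2.

Definition rV_uncons n (x : 'rV[R]_n.+1) : R * 'rV[R]_n :=
  (x ord0 ord0, \row_i x ord0 (lift ord0 i)).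

Lemma rV_cons0 n (p : R * 'rV[R]_n) : rV_cons p ord0 ord0 = p.1.
Proof.
rewrite (_ : rV_cons _ _ _ = row_mx (p.1)%:M p.2 ord0 (lshift n ord0)).
  by rewrite row_mxEl mxE.
by congr (row_mx _ _ _ _); exact/val_inj.
Qed.

Lemma rV_consS n (p : R * 'rV[R]_n) i :
  rV_cons p ord0 (lift ord0 i) = p.2 ord0 i.
Proof.
rewrite (_ : rV_cons _ _ _ = row_mx (p.1)%:M p.2 ord0 (rshift 1 i)).
  by rewrite row_mxEr.
by congr (row_mx _ _ _ _); exact/val_inj.
Qed.

Lemma rV_consK n : cancel (@rV_cons n) (@rV_uncons n).
Proof.
case=> a v; rewrite /rV_uncons rV_cons0; congr pair.
by apply/rowP => i; rewrite mxE rV_consS.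
Qed.

Lemma rV_unconsK n : cancel (@rV_uncons n) (@rV_cons n).
Proof.
move=> x; apply/rowP => i; case: (unliftP ord0 i) => [j|] ->.
  by rewrite rV_consS mxE.
by rewrite rV_cons0.
Qed.

Lemma measurable_rV_cons n : measurable_fun [set: R * 'rV[R]_n] (@rV_cons n).
Proof.
apply: measurable_fun_rV => i; case: (unliftP ord0 i) => [j|] ->.
  under eq_fun do rewrite rV_consS.
  apply: (measurableT_comp (measurable_coord j)); exact: measurable_snd.
by under eq_fun do rewrite rV_cons0; exact: measurable_fst.
Qed.

Lemma measurable_rV_uncons n :
  measurable_fun [set: 'rV[R]_n.+1] (@rV_uncons n).
Proof.
apply: measurable_fun_pair => /=; first exact: measurable_coord.
apply: measurable_fun_rV => i.
by under eq_fun do rewrite mxE; exact: measurable_coord.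
Qed.

HB.instance Definition _ n := isMeasurableFun.Build _ _ _ _ (@rV_cons n)
  (@measurable_rV_cons n).

Section step.
Variables (n : nat) (m : {sigma_finite_measure set 'rV[R]_n -> \bar R}).

Definition lebesgue_step : set 'rV[R]_n.+1 -> \bar R :=
  pushforward (lebesgue_measure \x m)%E (@rV_cons n).

Let step0 : lebesgue_step set0 = 0%E.
Proof. by rewrite /lebesgue_step /pushforward preimage_set0 measure0. Qed.

Let step_ge0 A : (0 <= lebesgue_step A)%E.
Proof. by rewrite /lebesgue_step /pushforward measure_ge0. Qed.

Let step_sigma_additive : semi_sigma_additive lebesgue_step.
Proof.
rewrite /lebesgue_step; apply: measure_semi_sigma_additive.
exact: measurable_rV_cons.
Qed.

HB.instance Definition _ := isMeasure.Build _ _ _ lebesgue_step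
  step0 step_ge0 step_sigma_additive.

Let step_sigma_finite : sigma_finite setT lebesgue_step.
Proof.
have /sigma_finiteP[F [TF ndF Foo]] := sigma_finiteT (@lebesgue_measure R).
have /sigma_finiteP[G [TG ndG Goo]] := sigma_finiteT m.
exists (fun k => @rV_uncons n @^-1` (F k `*` G k)).
  apply/seteqP; split=> // x _.
  have [k _ Fk] : (\bigcup_k F k) (rV_uncons x).1 by rewrite -TF.
  have [l _ Gl] : (\bigcup_l G l) (rV_uncons x).2 by rewrite -TG.
  exists (maxn k l) => //; split.
  - by move: Fk; exact/subsetPset/ndF/leq_maxl.
  - by move: Gl; exact/subsetPset/ndG/leq_maxr.
move=> k; have [mF Fk] := Foo k; have [mG Gk] := Goo k; split.
  rewrite -[X in measurable X]setTI; apply: measurable_rV_uncons => //.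
  exact: measurableX.
rewrite /lebesgue_step /pushforward -comp_preimage.
rewrite (_ : _ \o _ = id); last by apply/funext => x; exact: rV_consK.
by rewrite preimage_id product_measure1E// lte_mul_pinfty// ge0_fin_numE.
Qed.

HB.instance Definition _ :=
  Measure_isSigmaFinite.Build _ _ _ lebesgue_step step_sigma_finite.

End step.

(* The n-dimensional Lebesgue measure: the iterated product of the
   one-dimensional one (see lebesgue_rV_prod). *)
Fixpoint lebesgue_rV n : {sigma_finite_measure set 'rV[R]_n -> \bar R} :=
  if n is n'.+1 then lebesgue_step (lebesgue_rV n') else \d_(0 : 'rV[R]_0).

Lemma lebesgue_rV_prod n (A : 'I_n -> set R) : (forall i, measurable (A i)) ->
  lebesgue_rV n [set x | forall i, A i (x ord0 i)] =
    (\prod_(i < n) lebesgue_measure (A i))%E.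
Proof.
elim: n A => [|n IHn] A mA.
  by rewrite big_ord0 /= diracE mem_set//= => -[].
rewrite big_ord_recl -(IHn (fun i => A (lift ord0 i)))//=.
pose B := [set x : 'rV[R]_n | forall i, A (lift ord0 i) (x ord0 i)].
have mB : measurable B.
  rewrite (_ : B = \bigcap_(i in [set: 'I_n])
      ((fun x : 'rV[R]_n => x ord0 i) @^-1` A (lift ord0 i))).
    apply: fin_bigcap_measurable => // i _.
    by rewrite -[X in measurable X]setTI; exact: measurable_coord.
  by apply/seteqP; split=> x /= Ax i; [move=> _; exact: Ax|exact: Ax].
rewrite /lebesgue_step /pushforward (_ : _ @^-1` _ = A ord0 `*` B).
  by rewrite product_measure1E//; exact: mA.
apply/seteqP; split=> -[a v] /=.
  move=> Aav; split; first by have := Aav ord0; rewrite rV_cons0.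
  by move=> i; have := Aav (lift ord0 i); rewrite rV_consS.
by move=> [Aa Av] i; case: (unliftP ord0 i) => [j|] ->;
  rewrite ?rV_cons0 ?rV_consS.
Qed.

End lebesgue_rV.

Section domain.
Variables (R : realType) (d : nat).
Implicit Types (Omega : set 'rV[R]_d).

(* Near every boundary point, Omega is, in some orthonormal coordinates
   y = x *m Q, the strict supergraph {y_k > g(y_j, j != k)} of a Lipschitz
   function g. *)
Definition lipschitz_boundary Omega := forall x, (closure Omega `\` Omega) x ->
  exists (r : R) (Q : 'M[R]_d) (k : 'I_d) (g : 'rV[R]_d.-1 -> R) (L : R),
    [/\ 0 < r, Q *m Q^T = 1%:M, L.-lipschitz g &
      forall x', ball x r x' ->
        Omega x' <-> g (col' k (x' *m Q)) < (x' *m Q) ord0 k].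

Definition lipschitz_domain Omega :=
  [/\ open Omega, connected Omega, bounded_set Omega & lipschitz_boundary Omega].

(* Periodic a b: periodicity with cell prod_i (a_i, b_i). *)
Inductive boundary_condition := Neumann | Periodic (a b : 'rV[R]_d).

Definition compatible (bc : boundary_condition) Omega :=
  match bc with
  | Neumann => True
  | Periodic a b => (forall i, a ord0 i < b ord0 i) /\
      Omega = [set x | forall i, a ord0 i < x ord0 i < b ord0 i]
  end.

Definition shift_period (a b : 'rV[R]_d) (i : 'I_d) (x : 'rV[R]_d) :=
  x + (b ord0 i - a ord0 i) *: delta_mx ord0 i.

End domain.
Arguments Neumann {R d}.

(* An element is represented by its extension by 0 outside closure Omega, so
   that equality of representatives is equality of functions on closure Omega.
   Boundedness is automatic when closure Omega is compact; it is required so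
   that the supremum norm is defined for every Omega. *)
Section state_space.
Variables (R : realType) (d : nat).
Variables (Omega : set 'rV[R]_d) (bc : boundary_condition R d).

Definition is_state (f : 'rV[R]_d -> R) :=
  [/\ {within closure Omega, continuous f},
      forall x, ~ closure Omega x -> f x = 0,
      exists M, forall x, `|f x| <= M &
      match bc with
      | Neumann => True
      | Periodic a b => forall i x, closure Omega x ->
          closure Omega (shift_period a b i x) -> f (shift_period a b i x) = f x
      end].

Definition state_pred : {pred 'rV[R]_d -> R} := mem [set f | is_state f].

Record state := State { state_val :> 'rV[R]_d -> R; _ : state_val \in state_pred }.

HB.instance Definition _ := [isSub for state_val].
HB.instance Definition _ := [Choice of state by <:].

Lemma stateP (u : state) : is_state u.
Proof. by have := valP u; rewrite inE. Qed.

Lemma state_submod_closed : submod_closed state_pred.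
Proof.
split.
  rewrite inE; split => //.
  - by move=> x; exact: cvg_cst.
  - by exists 0 => x; rewrite normr0.
  - by case: bc.
move=> k f g; rewrite !inE => -[cf f0 [M fM] pf] [cg g0 [N gN] pg]; split.
- move=> x; apply: cvgD; last exact: cg.
  by apply: cvgZr; exact: cf.
- by move=> x Ox; rewrite !fctE f0// g0// scaler0 addr0.
- exists (`|k| * M + N) => x; rewrite !fctE (le_trans (ler_normD _ _))//.
  by rewrite lerD// normrM ler_wpM2l.
- case: bc pf pg => // a b pf pg i x Ox Oy.
  by rewrite !fctE pf// pg.
Qed.

HB.instance Definition _ := GRing.isSubmodClosed.Build R ('rV[R]_d -> R)
  state_pred state_submod_closed.
HB.instance Definition _ := [SubChoice_isSubLmodule of state by <:].

Implicit Types (u v : state).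

Definition sup_norm (u : state) : R := sup [set `|u x| | x in closure Omega].

Lemma sup_norm_ge0 u : 0 <= sup_norm u.
Proof.
have [cl0|/set0P [x Ox]] := eqVneq (closure Omega) set0.
  by rewrite /sup_norm cl0 image_set0 sup0.
have [_ _ [M uM] _] := stateP u.
apply: (le_trans (normr_ge0 (u x))); apply: ub_le_sup; last by exists x.
by exists M => _ [y _ <-].
Qed.

Lemma sup_norm_ub (u : state) x : `|u x| <= sup_norm u.
Proof.
have [_ u0 [M uM] _] := stateP u.
have [Ox|nOx] := pselect (closure Omega x).
  by apply: ub_le_sup; [exists M => _ [y _ <-]|exists x].
by rewrite u0// normr0 sup_norm_ge0.
Qed.

Lemma sup_norm_le (u : state) M : 0 <= M ->
  (forall x, closure Omega x -> `|u x| <= M) -> sup_norm u <= M.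
Proof.
move=> M0 uM; have [cl0|/set0P [x Ox]] := eqVneq (closure Omega) set0.
  by rewrite /sup_norm cl0 image_set0 sup0.
by apply: ge_sup; [exists `|u x|, x|move=> _ [y Oy <-]; exact: uM].
Qed.

Let ler_sup_normD u v : sup_norm (u + v) <= sup_norm u + sup_norm v.
Proof.
apply: sup_norm_le => [|x _]; first by rewrite addr_ge0 ?sup_norm_ge0.
by rewrite (le_trans (ler_normD _ _))// lerD// sup_norm_ub.
Qed.

Let sup_normZ k u : sup_norm (k *: u) = `|k| * sup_norm u.
Proof.
have le_scale l v : sup_norm (l *: v) <= `|l| * sup_norm v.
  apply: sup_norm_le => [|x _]; first by rewrite mulr_ge0 ?sup_norm_ge0.
  by rewrite normrM ler_wpM2l// sup_norm_ub.
apply/eqP; rewrite eq_le le_scale/=.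
have [->|k0] := eqVneq k 0; first by rewrite normr0 mul0r sup_norm_ge0.
have := le_scale k^-1 (k *: u).
by rewrite scalerA mulVf// scale1r normfV ler_pdivlMl ?normr_gt0.
Qed.

Let sup_norm_eq0 u : sup_norm u = 0 -> u = 0.
Proof.
move=> u0; apply/val_inj/funext => x; apply/eqP; rewrite -normr_le0 -u0.
exact: sup_norm_ub.
Qed.

HB.instance Definition _ := Lmodule_isNormed.Build R state
  ler_sup_normD sup_normZ sup_norm_eq0.

Lemma state_normE (u : state) : `|u| = sup_norm u.
Proof. by []. Qed.

Section composition.
Variables (h : R -> R) (ch : continuous h).

Lemma comp_is_state (u : state) : is_state ((h \o u) \_ (closure Omega)).
Proof.
have [cu u0 [M uM] pu] := stateP u; split.
- apply: (@subspace_eq_continuous _ _ _ (h \o u)).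
    by move=> x; rewrite inE => Ox; rewrite /from_subspace/= /patch mem_set.
  by move=> x; apply: (cvg_comp _ _ (cu x)); exact: ch.
- by move=> x nOx; rewrite patchE memNset.
- have /compact_bounded[N [_ hN]] : compact (h @` `[- M, M]).
    apply: continuous_compact; last exact: segment_compact.
    exact: continuous_subspaceT.
  exists (`|N| + 1) => x; rewrite patchE; case: ifPn => [_|_]; last first.
    by rewrite normr0 addr_ge0.
  apply: (hN (`|N| + 1)); first by rewrite (le_lt_trans (ler_norm _))// ltrDl.
  by exists (u x) => //=; rewrite in_itv/= -ler_norml.
- case: bc pu => // a b pu i x Ox Oy.
  by rewrite !patchE !mem_set//= pu.
Qed.

Definition state_comp (u : state) : state := State (mem_set (comp_is_state u)).

Lemma state_compE u x : closure Omega x -> state_comp u x = h (u x).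
Proof.
move=> Ox; rewrite (_ : _ x = ((h \o u) \_ (closure Omega)) x)//.
by rewrite patchE mem_set.
Qed.
End composition.

End state_space.

Section semigroup.
Variables (R : realType) (V : normedModType R).

Record contraction_semigroup (S : R -> V -> V) : Prop := {
  semigroup_linear : forall t, 0 <= t -> linear (S t);
  semigroup0 : S 0 =1 id;
  semigroupD : forall s t, 0 <= s -> 0 <= t -> S (s + t) =1 S s \o S t;
  semigroup_continuous : forall v, S t v @[t --> 0^'+] --> v;
  semigroup_contraction : forall t v, 0 <= t -> `|S t v| <= `|v| }.

(* A : V -> V -> Prop is the graph of an unbounded operator. *)
Definition generates (A : V -> V -> Prop) (S : R -> V -> V) := forall v w,
  A v w <-> t^-1 *: (S t v - v) @[t --> 0^'+] --> w.

End semigroup.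

Section laplacian.
Variables (R : realType) (d : nat).
Variables (Omega : set 'rV[R]_d) (bc : boundary_condition R d).
Local Notation E := 'rV[R]_d.
Local Notation leb := (lebesgue_rV R d).

Definition partial (i : 'I_d) (phi : E -> R) : E -> R :=
  'D_(delta_mx ord0 i) phi.

(* C^infinity: all iterated partial derivatives exist and are continuous. *)
Definition smooth (phi : E -> R) := forall s : seq 'I_d,
  continuous (foldr partial phi s) /\
  forall i x, derivable (foldr partial phi s) x (delta_mx ord0 i).

(* C_c^infinity(Omega), resp. the smooth functions periodic on R^d. *)
Definition test_function (phi : E -> R) := smooth phi /\
  match bc with
  | Neumann => compact (closure [set x | phi x != 0]) /\
      closure [set x | phi x != 0] `<=` Omega
  | Periodic a b => forall i x, phi (shift_period a b i x) = phi x
  end.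

Definition square_integrable (v : E -> R) := measurable_fun Omega v /\
  leb.-integrable Omega (fun x => (v x ^+ 2)%:E).

(* v belongs to H^1(Omega), resp. to H^1 of the torus, with weak gradient G. *)
Definition sobolev1 (v : E -> R) (G : 'I_d -> E -> R) :=
  [/\ square_integrable v, forall i, square_integrable (G i) &
    forall phi i, test_function phi ->
      \int[leb]_(x in Omega) (v x * partial i phi x) =
      - \int[leb]_(x in Omega) (G i x * phi x)].

(* laplacian u w: u is in the domain and Delta u = w.  On a Lipschitz domain the
   homogeneous Neumann condition has its usual variational meaning: Green's
   formula without boundary term holds against all of H^1(Omega). *)
Definition laplacian (u w : state Omega bc) := exists2 G,
  sobolev1 u G & forall v H, sobolev1 v H ->
    \int[leb]_(x in Omega) (\sum_i G i x * H i x) =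
    - \int[leb]_(x in Omega) (w x * v x).

End laplacian.

Section allen_cahn.
Variables (R : realType).

Definition ac_f (s : R) : R := s - s ^+ 3.
Definition ac_g (s : R) : R := 1 - s ^+ 2.

Lemma continuous_ac_f : continuous ac_f.
Proof.
by move=> s; apply: cvgB; [exact: cvg_id|exact: exprn_continuous].
Qed.

Lemma continuous_ac_g : continuous ac_g.
Proof.
by move=> s; apply: cvgB; [exact: cvg_cst|exact: exprn_continuous].
Qed.

Definition kappa_min : R := sup [set `|derive1 ac_f s| + `|derive1 ac_g s| | s in `[-1, 1]].

Lemma kappa_minE : kappa_min = 4.
Proof.
have f1 s : derive1 ac_f s = 1 - 3 * s ^+ 2.
  have -> : ac_f = id - (id : R -> R) ^+ 3.
    by apply/funext => x; rewrite /ac_f exprfctE.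
  by rewrite derive1E derive_val -[_ *: _]/(_ * _) /=; ring.
have g1 s : derive1 ac_g s = - (2 * s).
  have -> : ac_g = cst 1 - (id : R -> R) ^+ 2.
    by apply/funext => x; rewrite /ac_g exprfctE.
  by rewrite derive1E derive_val -[_ *: _]/(_ * _) /=; ring.
have fg (s : R) : -1 <= s <= 1 -> `|1 - 3 * s ^+ 2| + `|- (2 * s)| <= 4.
  move=> /andP[s1 s2]; have s3 : s ^+ 2 <= 1 by nra.
  have s4 := sqr_ge0 s.
  have : `|1 - 3 * s ^+ 2| <= 2 by rewrite ler_norml; lra.
  have : `|- (2 * s)| <= 2 by rewrite ler_norml; lra.
  lra.
apply/eqP; rewrite eq_le; apply/andP; split.
  apply: ge_sup; first by exists (`|derive1 ac_f 0| + `|derive1 ac_g 0|), 0 => //=;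
    rewrite in_itv/= lerN10 ler01.
  by move=> _ [s /= + <-]; rewrite in_itv/= f1 g1; exact: fg.
apply: ub_le_sup.
  by exists 4 => _ [s /= + <-]; rewrite in_itv/= f1 g1; exact: fg.
exists 1; first by rewrite /= in_itv/= lexx andbT; lra.
rewrite f1 g1 expr1n !mulr1 -opprB normrN normrN !ger0_norm; lra.
Qed.

Variables (d : nat) (Omega : set 'rV[R]_d) (bc : boundary_condition R d).
Local Notation X := (state Omega bc).
Local Notation leb := (lebesgue_rV R d).

Definition mass (v : 'rV[R]_d -> R) : R := \int[leb]_(x in Omega) v x.
Definition volume : R := fine (leb Omega).

(* Division by 0 gives 0: lambda xi is only meaningful if mass (g o xi) <> 0. *)
Definition lambda (xi : X) : R :=
  mass (fun x => ac_f (xi x)) / mass (fun x => ac_g (xi x)).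

Definition nonlinearity (kappa : R) (xi : X) : X :=
  kappa *: xi + state_comp continuous_ac_f xi
    - lambda xi *: state_comp continuous_ac_g xi.

Definition has_derivative_on (T : R) (u u' : R -> X) :=
  forall t, 0 <= t <= T ->
    (s - t)^-1 *: (u s - u t) @[s --> within `[0, T]%classic (t^')] --> u' t.

(* u is a solution on [0, T], of class C^1([0, T]; C(closure Omega)). *)
Definition exact_solution (eps T : R) (u0 : X) (u : R -> X) :=
  u 0 = u0 /\
  exists u', [/\ has_derivative_on T u u',
    {within `[0, T], continuous u'} &
    forall t, 0 < t <= T -> exists2 w, laplacian (u t) w &
      u' t = eps ^+ 2 *: w + state_comp continuous_ac_f (u t)
               - lambda (u t) *: state_comp continuous_ac_g (u t)].

(* exp(t L_kappa) = exp(- kappa t) exp(t eps^2 Delta), where S t = exp(t Delta). *)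
Definition etd_semigroup (S : R -> X -> X) (eps kappa t : R) (v : X) : X :=
  expR (- (kappa * t)) *: S (t * eps ^+ 2) v.

(* The C(closure Omega)-valued integral of a continuous function is evaluated
   pointwise, as point evaluations are continuous and linear. *)
Definition etd1 (S : R -> X -> X) (eps kappa tau : R) (u0 : X) (U : nat -> X) :=
  U 0%N = u0 /\
  forall n x, closure Omega x -> U n.+1 x =
    etd_semigroup S eps kappa tau (U n) x +
    \int[lebesgue_measure]_(s in `[0, tau])
      etd_semigroup S eps kappa (tau - s) (nonlinearity kappa (U n)) x.

Definition Cgamma (gamma : R) : R :=
  4 * volume / gamma + 2 * volume ^+ 2 / gamma ^+ 2.

Definition Cstar (gamma : R) : R := 3 / 2 + Cgamma gamma / 4.

End allen_cahn.

(* Main.v *)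
Require Import Defs.
From mathcomp Require Import all_boot all_order all_algebra.
From mathcomp Require Import all_classical all_reals all_analysis.
From mathcomp Require Import ring lra.
Set Implicit Arguments.
Unset Strict Implicit.
Unset Printing Implicit Defensive.
Import Order.TTheory GRing.Theory Num.Theory.
Import numFieldNormedType.Exports.
Local Open Scope classical_set_scope.
Local Open Scope ring_scope.

(** Write P for the semigroup generated by eps^2 Delta - kappa, N
for the nonlinearity and e_n for the norm of u(t_n) - u^n.  The variation of
constants formula on [t_n, t_n + tau], applied to u and to the scheme, gives

  u(t_n + tau) - u^(n+1) = P(tau) (u(t_n) - u^n)
     + integral over [0, tau] of P(tau - s) (N[u(t_n + s)] - N[u^n]) ds.

P(t) contracts by exp(- kappa t), and N is Lipschitz with constant Cs * kappa
on functions with values in [-1, 1] and mass of g at least gamma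
([nonlinearity_lipschitz]); the factor Cs * kappa comes from
kappa + f' - lambda g' lying in [0, 3/2 kappa], as |lambda| <= 1, and from
lambda being Lipschitz with constant 4 |Omega| / gamma.  If C bounds the norm
of u', then u is C-Lipschitz in time, whence

  e_(n+1) <= exp(- kappa tau) e_n
     + (1 - exp(- kappa tau)) / kappa * (Cs * kappa) * (C tau + e_n),

and a discrete Gronwall argument ([gronwall_step]) concludes.  The constant C
depends on the exact solution only, hence not on tau, gamma or kappa.

The variation of constants formula is used after evaluation at a point, and all
differential inequalities are reduced to one fact on real functions
([dini_le]): a continuous function whose upper right Dini derivative is
nonpositive does not increase.  It applies because only right derivatives of
t |-> P(tau - t) u(t) are needed, and these follow from
u(t + h) - P(h) u(t) = h N[u(t)] + o(h), that is, from the definition of the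
generator of P.  Point evaluations turn this into the scalar variation of
constants estimate [duhamel_bound].

Two maximum principles are needed, since N is controlled on [-1, 1] only.  For
the scheme, |N[u^n]| <= kappa and [duhamel_bound] with the zero function give
|u^(n+1)| <= 1.  For the exact solution, contractivity suffices: with
kappa = 0, u(t + h) = P(h) (u(t) + h N[u(t)]) + o(h), and since
the reaction term vanishes at 1 and -1, a small explicit Euler step of it
increases m = max(1, |u|) by at most h K (m - 1).  As m = 1 initially, m stays
equal to 1. *)

(** * A monotonicity criterion by Dini derivatives *)

(** If f rises above the line of slope e from its value at a, consider the last
point c at which it does not: the Dini condition at c produces later such
points.  As the condition is assumed in the open interval only, the line is
also raised by a constant e, which makes c > a by continuity. *)
Lemma dini_le (R : realType) (f : R -> R) (a b : R) : a <= b ->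
  {within `[a, b], continuous f} ->
  (forall x, a < x < b -> forall e, 0 < e ->
     \forall h \near 0^'+, f (x + h) - f x <= e * h) ->
  f b <= f a.
Proof.
move=> ab cf df; apply/ler_addgt0Pr => e0 e00.
have [->|neab] := eqVneq a b; first by rewrite lerDl ltW.
have {}ab : a < b by rewrite lt_neqAle neab.
(* chosen so that both the slope and the extra constant add up to e0 at b *)
set e := e0 / (b - a + 1).
have e_gt0 : 0 < e by rewrite divr_gt0//; lra.
have ba_e : e * (b - a) + e = e0 by rewrite /e; field; lra.
pose g s := f s - f a - e * (s - a) - e.
have gc x : a <= x <= b -> forall d, 0 < d ->
    exists2 r, 0 < r & forall y, a <= y <= b -> `|x - y| < r -> `|g x - g y| < d.
  move=> xab d d0.
  have /subspace_continuousP/(_ x) : {within `[a, b], continuous g}.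
    move=> y; rewrite /g; apply: cvgB; last exact: cvg_cst.
    apply: cvgB; first by apply: cvgB; [exact: cf|exact: cvg_cst].
    have : {within `[a, b], continuous (fun s : R => e * (s - a))}.
      apply: continuous_subspaceT => z; apply: cvgMr.
      by apply: cvgB; [exact: cvg_id|exact: cvg_cst].
    exact.
  rewrite /= in_itv/= => /(_ xab)/cvgrPdist_lt/(_ d d0)[r/= r0 xr].
  by exists r => // y yab xy; apply: xr => //; rewrite /= in_itv.
rewrite leNgt; apply/negP => fb.
have gb : 0 < g b by rewrite /g; lra.
pose A := [set s | a <= s <= b /\ g s <= 0].
have Aa : A a by split; [lra|rewrite /g; lra].
have supA : has_sup A by split; [exists a|exists b => s [/andP[]]].
(* the last point of A, by continuity of g *)
set c := sup A.
have acb : a <= c <= b.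
  apply/andP; split; first exact: (ub_le_sup supA.2).
  by apply: ge_sup; [exists a|move=> s [/andP[]]].
have gc0 : g c <= 0.
  rewrite leNgt; apply/negP => gc0; have [r r0 cr] := gc c acb _ gc0.
  have [s [sab gs]] := sup_adherent r0 supA; rewrite -/c => crs.
  have sc : s <= c by apply: (ub_le_sup supA.2); split.
  have := cr s sab; rewrite ger0_norm; last lra.
  by move=> /(_ ltac:(lra)); have := ler_norm (g c - g s); lra.
have ac : a < c.
  have [r r0 ar] := gc a ltac:(lra) e e_gt0.
  pose s := a + Num.min (r / 2) (b - a).
  have s0 : 0 < Num.min (r / 2) (b - a) by rewrite lt_min; apply/andP; split; lra.
  have s1 : Num.min (r / 2) (b - a) <= r / 2 by rewrite ge_min lexx.
  have s2 : Num.min (r / 2) (b - a) <= b - a by rewrite ge_min lexx orbT.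
  have sab : a <= s <= b by rewrite /s; lra.
  have := ar s sab; rewrite ltr_norml => /(_ ltac:(rewrite /s; lra)).
  rewrite ltr_norml => /andP[gs _]; apply: (@lt_le_trans _ _ s); first by rewrite /s; lra.
  apply: (ub_le_sup supA.2); split=> //.
  by move: gs; rewrite {1}/g; lra.
have cb : c < b.
  by rewrite lt_neqAle (andP acb).2 andbT; apply/eqP => cb; move: gc0; rewrite cb; lra.
have dc := df c ltac:(lra) e e_gt0.
near (0 : R)^'+ => h.
have h0 : 0 < h by [].
have hb : h < b - c by near: h; apply: nbhs_right_lt; lra.
have /= fh : f (c + h) - f c <= e * h by near: h.
suff /(ub_le_sup supA.2) : A (c + h) by rewrite -/c; lra.
split; first lra.
by have := gc0; rewrite /g; lra.
Unshelve. all: by end_near. Qed.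

(** * Contraction semigroups *)

Lemma is_derive_cvg_right (R : realType) (f : R -> R) (x df : R) :
  is_derive x 1 f df -> h^-1 * (f (x + h) - f x) @[h --> 0^'+] --> df.
Proof.
move=> [fx <-].
have : h^-1 *: ((f \o shift x) (h *: (1 : R)) - f x) @[h --> 0^'] --> 'D_1 f x.
  exact: fx.
move=> /cvg_dnbhs_at_right.
rewrite [X in X @ _ --> _ -> _](_ : _ = fun h : R => h^-1 * (f (x + h) - f x))//.
by apply/funext => h; rewrite /= -[h *: 1]/(h * 1) mulr1 (addrC h).
Qed.

Section contraction_semigroup_theory.
Variables (R : realType) (V : normedModType R) (S : R -> V -> V).
Hypothesis hS : contraction_semigroup S.

Lemma semigroupB t u v : 0 <= t -> S t (u - v) = S t u - S t v.
Proof.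
move=> t0; rewrite -[- v]scaleN1r addrC (semigroup_linear hS t0) scaleN1r.
by rewrite addrC.
Qed.

Lemma semigroup_zero t : 0 <= t -> S t 0 = 0.
Proof. by move=> t0; have := semigroupB 0 0 t0; rewrite !subrr. Qed.

Lemma semigroupZ t a u : 0 <= t -> S t (a *: u) = a *: S t u.
Proof.
by move=> t0; rewrite -{1}[a *: u]addr0 (semigroup_linear hS t0) semigroup_zero// addr0.
Qed.

Lemma semigroup_dist_le v s t : 0 <= s -> 0 <= t ->
  `|S s v - S t v| <= `|v - S `|s - t| v|.
Proof.
wlog st : s t / s <= t.
  move=> H s0 t0; have [st|/ltW ts] := leP s t; first exact: H.
  by rewrite distrC (distrC s); exact: H.
move=> s0 t0; have ts : 0 <= t - s by rewrite subr_ge0.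
rewrite (distrC s) [`|t - s|]ger0_norm//.
have -> : S t v = S s (S (t - s) v).
  by rewrite -[RHS]/((S s \o S (t - s)) v) -(semigroupD hS)// addrC subrK.
by rewrite -semigroupB// (semigroup_contraction hS).
Qed.

(** Right continuity at 0 is enough for two-sided uniform continuity of orbits:
up to sign, S s v - S t v is the image of v - S |s - t| v under a contraction. *)
Lemma semigroup_unif_continuous v e : 0 < e -> exists2 r, 0 < r &
  forall s t, 0 <= s -> 0 <= t -> `|s - t| < r -> `|S s v - S t v| < e.
Proof.
move=> e0; have /cvgrPdist_lt/(_ e e0)[r/= r0 vr] := @semigroup_continuous _ _ _ hS v.
exists r => // s t s0 t0 st; apply: (le_lt_trans (semigroup_dist_le v s0 t0)).
have [->|neq] := eqVneq `|s - t| 0; first by rewrite (semigroup0 hS)/= subrr normr0.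
by apply: vr; rewrite /= ?sub0r ?normrN ?normr_id// lt_def neq/=.
Qed.

End contraction_semigroup_theory.

(** The semigroup generated by c A - kappa when S is generated by A; the ETD
semigroup is the case c = eps^2. *)
Definition damped_semigroup (R : realType) (V : normedModType R)
  (S : R -> V -> V) (c kappa t : R) (v : V) : V :=
  expR (- (kappa * t)) *: S (t * c) v.

Section damped.
Variables (R : realType) (V : normedModType R) (S : R -> V -> V).
Hypothesis hS : contraction_semigroup S.
Variables (c kappa : R).
Hypotheses (c0 : 0 < c) (k0 : 0 <= kappa).
Local Notation P := (damped_semigroup S c kappa).

Lemma damped_decay t v : 0 <= t -> `|P t v| <= expR (- (kappa * t)) * `|v|.
Proof.
move=> t0; rewrite normrZ gtr0_norm ?expR_gt0// ler_wpM2l ?expR_ge0//.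
by apply: (semigroup_contraction hS); rewrite mulr_ge0// ltW.
Qed.

Lemma cvg_damping : expR (- (kappa * t)) @[t --> 0^'+] --> (1 : R).
Proof.
rewrite -expR0 -{2}oppr0 -{2}(mulr0 kappa).
apply: cvg_at_right_filter.
apply: (@continuous_comp _ _ _ (fun t => - (kappa * t)) expR).
  by apply: cvgN; apply: cvgMr; exact: cvg_id.
exact: continuous_expR.
Qed.

Lemma cvg_dilation : t * c @[t --> 0^'+] --> 0^'+.
Proof.
move=> A [r/= r0 Ar]; exists (r / c) => /=; first by rewrite divr_gt0.
move=> t/=; rewrite !sub0r !normrN => tr t0.
have tc : 0 < t * c by rewrite mulr_gt0.
apply: Ar => //=; rewrite sub0r normrN gtr0_norm// -ltr_pdivlMr//.
by rewrite gtr0_norm in tr.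
Qed.

Lemma damped_contraction_semigroup : contraction_semigroup P.
Proof.
have c0' := ltW c0; split.
- move=> t t0 a u v; rewrite /damped_semigroup (semigroup_linear hS) ?mulr_ge0//.
  by rewrite scalerDr !scalerA mulrC.
- by move=> v; rewrite /damped_semigroup mulr0 oppr0 expR0 mul0r scale1r (semigroup0 hS).
- move=> s t s0 t0 v; rewrite /damped_semigroup/= mulrDl (semigroupD hS) ?mulr_ge0//=.
  by rewrite semigroupZ ?mulr_ge0// scalerA -expRD mulrDr opprD.
- move=> v; rewrite -[X in _ --> X]scale1r; apply: cvgZ; first exact: cvg_damping.
  by apply: cvg_comp (@semigroup_continuous _ _ _ hS v); exact: cvg_dilation.
- move=> t v t0; apply: (le_trans (damped_decay v t0)).
  by rewrite ler_piMl// -expR0 ler_expR oppr_le0 mulr_ge0.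
Qed.

Lemma damped_generator v w :
  t^-1 *: (S t v - v) @[t --> 0^'+] --> w ->
  t^-1 *: (P t v - v) @[t --> 0^'+] --> c *: w - kappa *: v.
Proof.
move=> Svw.
have -> : c *: w - kappa *: v = (1 : R) *: (c *: w) + (- kappa) *: v.
  by rewrite scale1r scaleNr.
have : expR (- (kappa * t)) *: (c *: ((t * c)^-1 *: (S (t * c) v - v)))
   + (t^-1 *: (expR (- (kappa * t)) - 1)) *: v
   @[t --> 0^'+] --> (1 : R) *: (c *: w) + (- kappa) *: v.
  apply: cvgD.
    apply: cvgZ; first exact: cvg_damping.
    apply: cvgZr; exact: cvg_comp cvg_dilation Svw.
  apply: cvgZl.
  have d1 : is_derive (0 : R) 1 (fun t : R => - (kappa * t)) (- (kappa * 1)).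
    exact: (is_deriveN (is_deriveZ kappa (is_derive_id (0 : R) 1))).
  have d2 : is_derive (- (kappa * 0)) 1 expR (expR (- (kappa * 0))).
    exact: is_derive_expR.
  have := is_derive_cvg_right (@is_derive1_comp _ _ (fun t => - (kappa * t)) 0 _ _ d2 d1).
  rewrite mulr0 oppr0 expR0 mul1r mulr1.
  rewrite [X in X @ _ --> _ -> _](_ : _ =
    fun t : R => t^-1 *: (expR (- (kappa * t)) - 1))//.
  by apply/funext => t; rewrite /= add0r mulr0 oppr0 expR0.
apply: cvg_trans; apply: near_eq_cvg; near=> t.
have t0 : t != 0 by rewrite gt_eqF.
rewrite /damped_semigroup /=; set e := expR _; set Sv := S _ v.
have -> : e *: (c *: ((t * c)^-1 *: (Sv - v))) = t^-1 *: (e *: (Sv - v)).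
  by rewrite !scalerA; congr (_ *: _); field; rewrite t0 (gt_eqF c0).
rewrite -[(t^-1 *: (e - 1))]/(t^-1 * (e - 1)) -scalerA -scalerDr; congr (_ *: _).
by rewrite scalerBr scalerBl scale1r addrA subrK.
Unshelve. all: by end_near. Qed.
End damped.

(** * The variation of constants estimate *)

Section integral_increment.
Variables (R : realType) (k : R -> R) (a b : R).
Hypotheses (ab : a <= b) (ck : {within `[a, b], continuous k}).
Local Notation mu := (@lebesgue_measure R).
Let I s := \int[mu]_(r in `[a, s]) k r.

Let int_k : mu.-integrable `[a, b] (EFin \o k).
Proof. by apply: continuous_compact_integrable => //; exact: segment_compact. Qed.

Lemma within_continuous_primitive : {within `[a, b], continuous I}.
Proof. exact: parameterized_integral_continuous. Qed.

Lemma primitive_cvg_right s : a < s < b ->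
  h^-1 * (I (s + h) - I s) @[h --> 0^'+] --> k s.
Proof.
move=> /andP[as_ sb]; apply: is_derive_cvg_right.
have ks : {for s, continuous k}.
  apply: (within_continuous_continuous _ ck); first exact: lt_trans sb.
  by rewrite in_itv/= as_.
have [Is <-] := continuous_FTC1 sb int_k (a := BLeft a) as_ ks.
by apply: DeriveDef; [exact: Is|rewrite derive1E].
Qed.
End integral_increment.

Section duhamel.
Variables (R : realType) (V : normedModType R) (P : R -> V -> V).
Hypothesis hP : contraction_semigroup P.
Variable kappa : R.
Hypothesis k0 : 0 < kappa.
Hypothesis decayP : forall t v, 0 <= t -> `|P t v| <= expR (- (kappa * t)) * `|v|.
Local Notation mu := (@lebesgue_measure R).

Section functional.
Variable l : V -> R.
Hypotheses (lB : forall u v, l (u - v) = l u - l v)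
  (lZ : forall a u, l (a *: u) = a * l u) (l1 : forall u, `|l u| <= `|u|).

(** The contraction property gives equicontinuity of the operators P (tau - s),
hence joint continuity in s and in the vector. *)
Lemma within_continuous_backward tau (phi : R -> V) :
  {within `[0, tau], continuous phi} ->
  {within `[0, tau], continuous (fun s => l (P (tau - s) (phi s)))}.
Proof.
move=> cphi; apply/subspace_continuousP => s /=; rewrite in_itv/= => stau.
move/subspace_continuousP : cphi => /(_ s); rewrite /= in_itv/= => /(_ stau) cphi.
apply/cvgrPdist_lt => e e0.
have e20 : 0 < e / 2 by rewrite divr_gt0.
have [r r0 Pr] := semigroup_unif_continuous hP (phi s) e20.
move/cvgrPdist_lt : cphi => /(_ _ e20) cphi.
have nr : \forall y \near within `[0, tau]%classic (nbhs s), `|s - y| < r.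
  by apply: cvg_within; exact: nbhsx_ballx.
have := withinT `[0, tau]%classic (nbhs_filter s).
apply: filterS3 cphi nr => y sy yr; rewrite /= in_itv/= => ytau.
rewrite -lB (le_lt_trans (l1 _))// [e]splitr.
rewrite -(subrK (P (tau - y) (phi s)) (P (tau - s) _)) -addrA.
rewrite (le_lt_trans (ler_normD _ _))// ltrD//.
  apply: Pr; rewrite ?subr_ge0; try lra.
  by rewrite (_ : _ - _ = - (s - y)) ?normrN//; ring.
rewrite -(semigroupB hP); last lra.
by rewrite (le_lt_trans (semigroup_contraction hP _ _))//; lra.
Qed.

(** Compare s |-> l (P (tau - s) (phi s)) with its value for the constant source
N0 plus the primitive of exp (- kappa (tau - s)) D.  The increment of the first
is l (P (tau - s - h) (phi (s + h) - P h (phi s))), so its right derivative is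
l (P (tau - s) (G s)), by strong continuity alone. *)
Lemma duhamel_le tau (phi G : R -> V) (N0 : V) (D : R) : 0 <= tau ->
  {within `[0, tau], continuous phi} ->
  (forall s, 0 < s < tau ->
    h^-1 *: (phi (s + h) - P h (phi s)) @[h --> 0^'+] --> G s) ->
  (forall s, 0 < s < tau -> `|G s - N0| <= D) ->
  l (phi tau) - l (P tau (phi 0)) -
    \int[mu]_(s in `[0, tau]) l (P (tau - s) N0)
  <= (1 - expR (- (kappa * tau))) / kappa * D.
Proof.
move=> tau0 cphi dphi GN.
pose k s := l (P (tau - s) N0).
pose I s := \int[mu]_(r in `[0, s]) k r.
(* the primitive of exp (- kappa (tau - s)) D *)
pose m s := expR (- (kappa * (tau - s))) / kappa * D.
have ck : {within `[0, tau], continuous k}.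
  by apply: within_continuous_backward => s; exact: cvg_cst.
pose f s := l (P (tau - s) (phi s)) - I s - m s.
suff : f tau <= f 0.
  have I0 : I 0 = 0 by rewrite /I set_itv1 Rintegral_set1.
  have -> : (1 - expR (- (kappa * tau))) / kappa * D = m tau - m 0.
    by rewrite /m subr0 subrr mulr0 oppr0 expR0; ring.
  have -> : \int[mu]_(s in `[0, tau]) l (P (tau - s) N0) = I tau by [].
  rewrite /f I0 !subr0 subrr (semigroup0 hP)/=.
  move: (l _) (l _) (I _) (m _) (m _) => *; lra.
apply: dini_le => //.
  move=> s; rewrite /f; apply: cvgB; first apply: cvgB.
  - exact: within_continuous_backward.
  - exact: within_continuous_primitive.
  - have : {within `[0, tau], continuous m}.
      apply: continuous_subspaceT => x; rewrite /m.
      apply: cvgMl; apply: cvgMl.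
      apply: (@continuous_comp _ _ _ (fun t => - (kappa * (tau - t))) expR).
        apply: cvgN; apply: cvgMr; apply: cvgB; [exact: cvg_cst|exact: cvg_id].
      exact: continuous_expR.
    exact.
move=> s stau e e0.
have e3 : 0 < e / 3 by rewrite divr_gt0.
have := primitive_cvg_right ck stau.
move=> /cvgrPdist_lt/(_ _ e3) dI.
move: (dphi _ stau) => /cvgrPdist_lt/(_ _ e3) dp.
have [r r0 Pr] := semigroup_unif_continuous hP (G s) e3.
near=> h.
have h0 : 0 < h by [].
have hr : h < r by near: h; exact: nbhs_right_lt.
have htau : h < tau - s by near: h; apply: nbhs_right_lt; lra.
have /= hI : `|k s - h^-1 * (I (s + h) - I s)| < e / 3 by near: h.
have /= hp : `|G s - h^-1 *: (phi (s + h) - P h (phi s))| < e / 3 by near: h.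
have hm : h * (expR (- (kappa * (tau - s))) * D) <= m (s + h) - m s.
  have D0 : 0 <= D by apply: le_trans (GN _ stau).
  rewrite /m -mulrBl -mulrBl mulrA ler_wpM2r// ler_pdivlMr//.
  have -> : - (kappa * (tau - (s + h))) = - (kappa * (tau - s)) + kappa * h by ring.
  rewrite expRD; have := expR_ge1Dx (kappa * h).
  have := expR_gt0 (- (kappa * (tau - s))); nra.
have hphi : l (P (tau - (s + h)) (phi (s + h))) - l (P (tau - s) (phi s))
    <= h * (l (P (tau - s) (G s)) + e / 3 + e / 3).
  have -> : P (tau - s) (phi s) = P (tau - (s + h)) (P h (phi s)).
    rewrite -[RHS]/((P (tau - (s + h)) \o P h) (phi s)) -(semigroupD hP); [|lra..].
    by congr (P _ _); ring.
  rewrite -lB -(semigroupB hP); last lra.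
  set q := h^-1 *: (phi (s + h) - P h (phi s)) in hp.
  have -> : phi (s + h) - P h (phi s) = h *: q.
    by rewrite /q scalerA divff ?scale1r// gt_eqF.
  rewrite (semigroupZ hP) ?lZ; last lra.
  rewrite ler_pM2l//.
  have h1 : `|l (P (tau - (s + h)) (G s)) - l (P (tau - (s + h)) q)| <= e / 3.
    rewrite -lB (le_trans (l1 _))// -(semigroupB hP); last lra.
    by rewrite (le_trans (semigroup_contraction hP _ _) (ltW hp))//; lra.
  have h2 : `|l (P (tau - s) (G s)) - l (P (tau - (s + h)) (G s))| <= e / 3.
    rewrite -lB (le_trans (l1 _))// ltW// Pr//; try lra.
    by rewrite (_ : _ - _ = h) ?gtr0_norm//; ring.
  by move: h1 h2; rewrite !ler_norml; lra.
have hG : l (P (tau - s) (G s)) - k s <= expR (- (kappa * (tau - s))) * D.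
  rewrite /k -lB -(semigroupB hP); last lra.
  apply: (le_trans (ler_norm _)); apply: (le_trans (l1 _)).
  apply: (le_trans (decayP _ _)); first lra.
  by rewrite ler_wpM2l ?expR_ge0// GN.
have hI' : h * (k s - e / 3) <= I (s + h) - I s.
  rewrite -ler_pdivlMl//; move: hI; rewrite ltr_norml; lra.
rewrite /f; nra.
Unshelve. all: by end_near. Qed.

End functional.

Lemma duhamel_bound (l : V -> R) tau (phi G : R -> V) (N0 : V) (D : R) :
  (forall u v, l (u - v) = l u - l v) -> (forall a u, l (a *: u) = a * l u) ->
  (forall u, `|l u| <= `|u|) -> 0 <= tau ->
  {within `[0, tau], continuous phi} ->
  (forall s, 0 < s < tau ->
    h^-1 *: (phi (s + h) - P h (phi s)) @[h --> 0^'+] --> G s) ->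
  (forall s, 0 < s < tau -> `|G s - N0| <= D) ->
  `|l (phi tau) - l (P tau (phi 0)) -
    \int[mu]_(s in `[0, tau]) l (P (tau - s) N0)|
  <= (1 - expR (- (kappa * tau))) / kappa * D.
Proof.
move=> lB lZ l1 tau0 cphi dphi GN; rewrite ler_norml; apply/andP; split; last first.
  exact: (duhamel_le lB lZ l1 tau0 cphi dphi GN).
(* the lower bound is the upper bound for - l *)
pose l' u := - l u.
have := @duhamel_le l' _ _ _ tau phi G N0 D tau0 cphi dphi GN.
rewrite /l'.
have -> : \int[mu]_(s in `[0, tau]) (- l (P (tau - s) N0)) =
   - \int[mu]_(s in `[0, tau]) l (P (tau - s) N0).
  under eq_Rintegral do rewrite -mulN1r.
  rewrite RintegralZl ?mulN1r//; apply: continuous_compact_integrable.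
    exact: segment_compact.
  by apply: (within_continuous_backward lB l1) => s; exact: cvg_cst.
rewrite lerNl opprB opprB => H; apply: le_trans (H _ _ _); first lra.
- by move=> u v; rewrite lB; ring.
- by move=> a u; rewrite lZ; ring.
- by move=> u; rewrite normrN.
Qed.
End duhamel.

(** * Lebesgue measure on bounded open sets, and mass *)

Section lebesgue_rV_topology.
Variables (R : realType) (n : nat).
Local Notation leb := (lebesgue_rV R n).

Lemma measurable_box (A : 'I_n -> set R) : (forall i, measurable (A i)) ->
  measurable [set x : 'rV[R]_n | forall i, A i (x ord0 i)].
Proof.
move=> mA.
rewrite (_ : [set x | _] = \bigcap_(i in [set: 'I_n])
    ((fun x : 'rV[R]_n => x ord0 i) @^-1` A i)).
  apply: fin_bigcap_measurable => // i _.
  by rewrite -[X in measurable X]setTI; exact: measurable_coord.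
by apply/seteqP; split=> x /= Ax i; [move=> _; exact: Ax|exact: Ax].
Qed.

(** The sigma-algebra is generated by the coordinates, so an open set is
measurable as a countable union of boxes with rational centres and sizes. *)
Lemma open_measurable_rV (A : set 'rV[R]_n) : open A -> measurable A.
Proof.
move=> oA.
pose B (p : 'rV[rat]_n * rat) := [set x : 'rV[R]_n |
  forall i, `](ratr (p.1 ord0 i) - ratr p.2 : R), ratr (p.1 ord0 i) + ratr p.2[%classic
    (x ord0 i)].
pose F p := if pselect (B p `<=` A) then B p else set0.
have -> : A = \bigcup_p F p.
  apply/seteqP; split => [x Ax|x [p _]]; last by rewrite /F; case: pselect => // BA /BA.
  have [r /= r0 xrA] : exists2 r : R, 0 < r & ball x r `<=` A.
    by apply/nbhs_ballP; exact: open_nbhs_nbhs.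
  have [q0] := rat_in_itvoo (divr_gt0 r0 (ltr0n R 2)).
  rewrite in_itv/= => /andP[q00 q0r].
  have /choice[q qx] i : exists q : rat, ratr q \in `]x ord0 i - ratr q0, x ord0 i + ratr q0[.
    by apply: rat_in_itvoo; lra.
  exists (\row_i q i, q0) => //; rewrite /F; case: pselect => [BA|[]] /=.
    move=> i; rewrite mxE /= in_itv/=; have := qx i; rewrite in_itv/=; lra.
  move=> y By; apply: xrA; split => // i j; rewrite (ord1 i).
  have := By j; rewrite mxE /= in_itv/=; have := qx j; rewrite in_itv/= => h1 h2.
  by rewrite /ball/= ltr_norml; lra.
apply: countable_bigcupT_measurable => // p.
rewrite /F; case: pselect => [?|?]; last exact: measurable0.
apply: (@measurable_box (fun i =>
  `](ratr (p.1 ord0 i) - ratr p.2 : R), ratr (p.1 ord0 i) + ratr p.2[%classic)) => i.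
exact: measurable_itv.
Qed.

Lemma lebesgue_rV_bounded (A : set 'rV[R]_n) : measurable A -> bounded_set A ->
  (leb A < +oo)%E.
Proof.
move=> mA [M0 [_ AM0]]; pose M := M0 + 1.
have AM x : A x -> `|x| <= M by apply: AM0; rewrite ltrDl.
have sub : A `<=` [set x : 'rV[R]_n | forall i, `[- M, M]%classic (x ord0 i)].
  move=> x Ax i; have xM := AM x Ax; rewrite /= in_itv/= -ler_norml; apply: le_trans xM.
  have /mapP[j Hj ->] : `|x ord0 i| \in [seq `|x k.1 k.2| | k : 'I_1 * 'I_n].
    by apply/mapP; exists (ord0, i) => //=; rewrite mem_enum.
  by rewrite [leRHS]/Num.norm /= mx_normrE; apply/bigmax_geP; right => /=; exists j.
have mbox : measurable [set x : 'rV[R]_n | forall i, `[- M, M]%classic (x ord0 i)].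
  by apply: (@measurable_box (fun=> `[- M, M]%classic)) => i; exact: measurable_itv.
apply: (@le_lt_trans _ _ (leb [set x : 'rV[R]_n | forall i, `[- M, M]%classic (x ord0 i)])).
  by apply: le_measure => //; rewrite inE.
rewrite (lebesgue_rV_prod (A := fun=> `[- M, M]%classic)); last first.
  by move=> i; exact: measurable_itv.
rewrite ltey_eq; apply/orP; left; elim/big_ind: _ => // [x y|i _].
  exact: fin_numM.
by rewrite lebesgue_measure_itv; case: ifP => _; rewrite ?fin_numB.
Qed.

Lemma open_continuous_measurable_rV (A : set 'rV[R]_n) (f : 'rV[R]_n -> R) :
  open A -> {within closure A, continuous f} -> measurable_fun A f.
Proof.
move=> oA cf; have {}cf : {in A, continuous f}.
  rewrite -(continuous_open_subspace f oA).
  by apply: continuous_subspaceW cf; exact: subset_closure.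
apply: (measurability _ (measurable_realfun.RGenOInfty.measurableE R)) => _ [_ [a ->] <-].
apply: open_measurable_rV; rewrite openE => x [Ax /= fa].
have xA : x \in A by rewrite inE.
apply: filterI; first exact: open_nbhs_nbhs.
apply: (cf x xA); apply: open_nbhs_nbhs; split=> //.
Qed.
End lebesgue_rV_topology.

Section mass.
Variables (R : realType) (d : nat) (Omega : set 'rV[R]_d).
Variable bc : boundary_condition R d.
Hypotheses (oO : open Omega) (bO : bounded_set Omega).
Local Notation X := (state Omega bc).
Local Notation leb := (lebesgue_rV R d).
Implicit Types u v : X.

Let mO : measurable Omega. Proof. exact: open_measurable_rV. Qed.

Lemma state_integrable u : leb.-integrable Omega (EFin \o u).
Proof.
have [cu _ [M uM] _] := stateP u.
apply: measurable_bounded_integrable => //.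
- exact: lebesgue_rV_bounded.
- exact: open_continuous_measurable_rV.
- exists M; split=> [|N MN x _]; first exact: num_real.
  exact: (le_trans (uM x) (ltW MN)).
Qed.

Lemma massB u v : mass Omega (u - v) = mass Omega u - mass Omega v.
Proof. by rewrite /mass -RintegralB//; exact: state_integrable. Qed.

Lemma mass_le (f g : X) : (forall x, Omega x -> f x <= g x) ->
  mass Omega f <= mass Omega g.
Proof. by move=> fg; apply: le_Rintegral => //; exact: state_integrable. Qed.

Lemma massN u : mass Omega (- u) = - mass Omega u.
Proof.
by rewrite -sub0r massB -{1}(subrr u) massB subrr sub0r.
Qed.

Lemma normr_mass_le (f g : X) : (forall x, Omega x -> `|f x| <= g x) ->
  `|mass Omega f| <= mass Omega g.
Proof.
move=> fg; rewrite ler_norml -massN !mass_le// => x /fg; rewrite ler_norml.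
  by move=> /andP[].
by case/andP.
Qed.

Lemma normr_mass u : `|mass Omega u| <= volume Omega * `|u|.
Proof.
have icst (c : R) : leb.-integrable Omega (EFin \o cst c).
  apply: measurable_bounded_integrable => //.
  - exact: lebesgue_rV_bounded.
  - exists `|c|; split=> [|N MN x _]; first exact: num_real.
    exact: ltW.
have vol c : volume Omega * c = \int[leb]_(x in Omega) cst c x.
  by rewrite Rintegral_cst// mulrC.
rewrite ler_norml -mulrN !vol; apply/andP; split; apply: le_Rintegral => //.
- exact: state_integrable.
- by move=> x _; have := sup_norm_ub u x; rewrite ler_norml => /andP[].
- exact: state_integrable.
- by move=> x _; have := sup_norm_ub u x; rewrite ler_norml => /andP[].
Qed.

Lemma volume_ge0 : 0 <= volume Omega.
Proof. exact: fine_ge0. Qed.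

(** Replacing h o u by a state makes the linearity and the bounds of mass on
states available for the masses of f(u) and g(u). *)
Lemma mass_comp (h : R -> R) (ch : continuous h) u :
  mass Omega (fun x => h (u x)) = mass Omega (state_comp ch u).
Proof.
apply: eq_Rintegral => x; rewrite inE => Ox.
by rewrite state_compE//; exact: subset_closure.
Qed.

End mass.

(** * Estimates for the nonlinearity *)

Section reaction.
Variables (R : realType) (d : nat) (Omega : set 'rV[R]_d).
Variable bc : boundary_condition R d.
Hypotheses (oO : open Omega) (bO : bounded_set Omega).
Local Notation X := (state Omega bc).
Implicit Types u v : X.

Lemma state_subE u v x : (u - v) x = u x - v x. Proof. by []. Qed.

Lemma unit_ball_range u x : `|u| <= 1 -> -1 <= u x <= 1.
Proof. by move=> u1; rewrite -ler_norml (le_trans (sup_norm_ub u x)). Qed.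

(** On [-1, 1], |f(s)| = |s| g(s) <= g(s).  A vanishing denominator is harmless
because the quotient is then 0. *)
Lemma normr_lambda_le1 u : `|u| <= 1 -> `|lambda u| <= 1.
Proof.
move=> u1; rewrite /lambda (mass_comp (@continuous_ac_f R)) (mass_comp (@continuous_ac_g R)).
set F := mass _ _; set G := mass _ _.
have FG : `|F| <= G.
  apply: normr_mass_le => // x Ox; have cx := subset_closure Ox.
  rewrite !state_compE// /ac_f /ac_g; have /andP[h1 h2] := unit_ball_range x u1.
  move: (u x) h1 h2 => s h1 h2.
  have : 0 <= (1 - s) * (1 + s) ^+ 2 by rewrite mulr_ge0 ?sqr_ge0//; lra.
  have : 0 <= (1 + s) * (1 - s) ^+ 2 by rewrite mulr_ge0 ?sqr_ge0//; lra.
  by rewrite ler_norml => *; apply/andP; split; lra.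
have G0 : 0 <= G by exact: le_trans FG.
have [->|Gneq] := eqVneq G 0; first by rewrite invr0 mulr0 normr0.
have Gpos : 0 < G by rewrite lt_def Gneq.
by rewrite normrM normfV (gtr0_norm Gpos) ler_pdivrMr// mul1r.
Qed.

Lemma state_comp_lipschitz (h : R -> R) (ch : continuous h) (K : R) u v :
  0 <= K -> (forall s t, -1 <= s <= 1 -> -1 <= t <= 1 -> `|h s - h t| <= K * `|s - t|) ->
  `|u| <= 1 -> `|v| <= 1 ->
  `|state_comp ch u - state_comp ch v| <= K * `|u - v|.
Proof.
move=> K0 hK u1 v1; apply: sup_norm_le => [|x Ox]; first by rewrite mulr_ge0.
rewrite state_subE !state_compE//.
apply: le_trans (hK _ _ (unit_ball_range x u1) (unit_ball_range x v1)) _.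
by rewrite ler_wpM2l// -state_subE sup_norm_ub.
Qed.

Lemma ac_f_lipschitz (s t : R) : -1 <= s <= 1 -> -1 <= t <= 1 ->
  `|ac_f s - ac_f t| <= 2 * `|s - t|.
Proof.
move=> /andP[s1 s2] /andP[t1 t2].
have -> : ac_f s - ac_f t = (1 - (s ^+ 2 + s * t + t ^+ 2)) * (s - t).
  by rewrite /ac_f; ring.
by rewrite normrM ler_wpM2r// ler_norml; apply/andP; split; nra.
Qed.

Lemma ac_g_lipschitz (s t : R) : -1 <= s <= 1 -> -1 <= t <= 1 ->
  `|ac_g s - ac_g t| <= 2 * `|s - t|.
Proof.
move=> /andP[s1 s2] /andP[t1 t2].
have -> : ac_g s - ac_g t = (- (s + t)) * (s - t) by rewrite /ac_g; ring.
by rewrite normrM ler_wpM2r// ler_norml; apply/andP; split; lra.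
Qed.

(** (lambda u - lambda v) times the mass of g(u) is the mass of f(u) - f(v) minus
lambda v times that of g(u) - g(v); here |lambda v| <= 1, and f and g are
2-Lipschitz on [-1, 1]. *)
Lemma lambda_lipschitz (gamma : R) u v : `|u| <= 1 -> `|v| <= 1 -> 0 < gamma ->
  gamma <= mass Omega (fun x => ac_g (u x)) ->
  gamma <= mass Omega (fun x => ac_g (v x)) ->
  `|lambda u - lambda v| <= 4 * volume Omega / gamma * `|u - v|.
Proof.
move=> u1 v1 g0 gu gv; have lv := normr_lambda_le1 v1.
have : (lambda v) * mass Omega (fun x => ac_g (v x)) = mass Omega (fun x => ac_f (v x)).
  by rewrite /lambda divfK// gt_eqF// (lt_le_trans g0).
have : (lambda u) * mass Omega (fun x => ac_g (u x)) = mass Omega (fun x => ac_f (u x)).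
  by rewrite /lambda divfK// gt_eqF// (lt_le_trans g0).
move: gu gv; rewrite !(mass_comp (@continuous_ac_f R)) !(mass_comp (@continuous_ac_g R)).
set Fu := mass _ (state_comp (@continuous_ac_f R) u); set Fv := mass _ (state_comp (@continuous_ac_f R) v).
set Gu := mass _ (state_comp (@continuous_ac_g R) u); set Gv := mass _ (state_comp (@continuous_ac_g R) v).
move=> gu gv uE vE; have V0 := volume_ge0 Omega.
set D := volume Omega * (2 * `|u - v|).
have dF : `|Fu - Fv| <= D.
  rewrite /Fu /Fv -massB//; apply: le_trans (normr_mass _ _ _) _ => //.
  by rewrite ler_wpM2l// state_comp_lipschitz//; exact: ac_f_lipschitz.
have dG : `|Gu - Gv| <= D.
  rewrite /Gu /Gv -massB//; apply: le_trans (normr_mass _ _ _) _ => //.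
  by rewrite ler_wpM2l// state_comp_lipschitz//; exact: ac_g_lipschitz.
have D0 : 0 <= D by apply: le_trans dF.
have Gu0 : 0 < Gu by exact: lt_le_trans gu.
have E : `|lambda u - lambda v| * Gu <= D + D.
  rewrite -[X in _ * X](gtr0_norm Gu0) -normrM.
  have -> : (lambda u - lambda v) * Gu = (Fu - Fv) - lambda v * (Gu - Gv).
    by rewrite -uE -vE; ring.
  rewrite (le_trans (ler_normB _ _))// lerD// normrM.
  by rewrite (le_trans _ dG)// ler_piMl.
have -> : 4 * volume Omega / gamma * `|u - v| = (D + D) / gamma.
  by rewrite /D; ring.
rewrite ler_pdivlMr//; apply: le_trans E.
by rewrite ler_wpM2l.
Qed.

Lemma nonlinearityE kappa u x : closure Omega x ->
  nonlinearity kappa u x =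
  kappa * u x + ac_f (u x) - lambda u * ac_g (u x).
Proof.
move=> Ox.
rewrite -[LHS]/(kappa * u x + state_comp (@continuous_ac_f R) u x -
  lambda u * state_comp (@continuous_ac_g R) u x).
by rewrite !state_compE.
Qed.

(** kappa s + f(s) - l g(s) equals kappa at s = 1 and - kappa at s = -1, and it
is monotone in between when |l| <= 1 and kappa >= 4; the factorizations below
express this. *)
Lemma normr_nonlinearity kappa u : 4 <= kappa -> `|u| <= 1 ->
  `|nonlinearity kappa u| <= kappa.
Proof.
move=> k4 u1; apply: sup_norm_le => [|x Ox]; first lra.
rewrite nonlinearityE// /ac_f /ac_g; have /andP[s1 s2] := unit_ball_range x u1.
have := normr_lambda_le1 u1; rewrite ler_norml; move: (lambda u) (u x) s1 s2 => l s s1 s2.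
move=> /andP[l1 l2].
have e1 : kappa - (kappa * s + (s - s ^+ 3) - l * (1 - s ^+ 2)) =
  (1 - s) * (kappa - (1 + s) * (s - l)) by ring.
have e2 : kappa + (kappa * s + (s - s ^+ 3) - l * (1 - s ^+ 2)) =
  (1 + s) * (kappa + (1 - s) * (s - l)) by ring.
have p1 : 0 <= (1 - s) * (kappa - (1 + s) * (s - l)).
  by apply: mulr_ge0; nra.
have p2 : 0 <= (1 + s) * (kappa + (1 - s) * (s - l)).
  by apply: mulr_ge0; nra.
by rewrite ler_norml; apply/andP; split; lra.
Qed.

(** The difference quotient is kappa + q with
q = 1 - (s^2 + s t + t^2) + l (s + t), and -4 <= q <= 2 <= kappa / 2. *)
Lemma reaction_lipschitz (kappa l s t : R) : 4 <= kappa -> -1 <= l <= 1 ->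
  -1 <= s <= 1 -> -1 <= t <= 1 ->
  `|(kappa * s + ac_f s - l * ac_g s) - (kappa * t + ac_f t - l * ac_g t)|
  <= 3 / 2 * kappa * `|s - t|.
Proof.
move=> k4 /andP[l1 l2] /andP[s1 s2] /andP[t1 t2]; rewrite /ac_f /ac_g.
set A := (X in `|X|).
have -> : A = (kappa + 1 - (s ^+ 2 + s * t + t ^+ 2) + l * (s + t)) * (s - t).
  by rewrite /A; ring.
(* p2 is the square completion behind q <= 1 + l^2 / 3 *)
have q3 : s ^+ 2 + s * t + t ^+ 2 <= 3 by nra.
have lst : -2 <= l * (s + t) by nra.
have l2' : l ^+ 2 <= 1 by nra.
have d2 := sqr_ge0 (s - t); have p2 := sqr_ge0 (3 * (s + t) - 2 * l).
rewrite normrM ler_wpM2r// ler_norml; apply/andP; split; nra.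
Qed.

Lemma nonlinearity_lipschitz (kappa gamma : R) u v : 4 <= kappa ->
  `|u| <= 1 -> `|v| <= 1 -> 0 < gamma ->
  gamma <= mass Omega (fun x => ac_g (u x)) ->
  gamma <= mass Omega (fun x => ac_g (v x)) ->
  `|nonlinearity kappa u - nonlinearity kappa v|
    <= Cstar Omega gamma * kappa * `|u - v|.
Proof.
move=> k4 u1 v1 g0 gu gv; have V0 := volume_ge0 Omega.
have Vg : 0 <= volume Omega / gamma by rewrite divr_ge0// ltW.
have Lk : 3 / 2 * kappa + 4 * volume Omega / gamma <= Cstar Omega gamma * kappa.
  have -> : 4 * volume Omega / gamma = 4 * (volume Omega / gamma) by rewrite mulrA.
  have -> : Cstar Omega gamma = 3 / 2 +
      (4 * (volume Omega / gamma) + 2 * (volume Omega / gamma) ^+ 2) / 4.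
    by rewrite /Cstar /Cgamma expr_div_n; ring.
  move: (volume Omega / gamma) Vg => q q0.
  have := sqr_ge0 q; nra.
apply: (@le_trans _ _ ((3 / 2 * kappa + 4 * volume Omega / gamma) * `|u - v|)); last first.
  by rewrite ler_wpM2r.
apply: sup_norm_le => [|x Ox].
  by rewrite mulr_ge0// -mulrA; nra.
rewrite state_subE !nonlinearityE//.
have ux := unit_ball_range x u1; have vx := unit_ball_range x v1.
set B := (X in `|X|).
have -> : B = ((kappa * u x + ac_f (u x) - lambda u * ac_g (u x)) -
   (kappa * v x + ac_f (v x) - lambda u * ac_g (v x))) -
   (lambda u - lambda v) * ac_g (v x) by rewrite /B; ring.
rewrite [leRHS]mulrDl (le_trans (ler_normB _ _))// lerD//.
  apply: (le_trans (reaction_lipschitz _ _ _ _)) => //.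
    by rewrite -ler_norml; exact: normr_lambda_le1.
  by rewrite ler_wpM2l -?state_subE ?sup_norm_ub//; lra.
rewrite normrM; apply: le_trans (lambda_lipschitz u1 v1 g0 gu gv).
rewrite ler_piMr// /ac_g ler_norml; move: vx => /andP[]; nra.
Qed.

(** An explicit Euler step of the reaction equation may leave [-rho, rho] only
through the excess rho - 1, because f - l g vanishes at 1 and -1.  For h small
the step is monotone in s, so the extreme case is s = rho. *)
Lemma reaction_step (M L h l rho s : R) : 0 <= M -> 0 <= L ->
  `|l| <= L -> 1 <= rho <= M -> `|s| <= rho -> 0 < h ->
  h * (3 * M ^+ 2 + 2 * L * M) <= 1 ->
  `|s + h * (ac_f s - l * ac_g s)| <= rho + h * ((M + 1) * L) * (rho - 1).
Proof.
wlog: l s / 0 <= s + h * (ac_f s - l * ac_g s).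
  move=> H M0 L0 lL rM sr h0 hh.
  have [|/ltW] := leP 0 (s + h * (ac_f s - l * ac_g s)); first by move=> ?; exact: H.
  move=> neg; rewrite -normrN.
  have E : - (s + h * (ac_f s - l * ac_g s)) =
    (- s) + h * (ac_f (- s) - (- l) * ac_g (- s)) by rewrite /ac_f /ac_g; ring.
  by rewrite E; apply: H; rewrite ?normrN// -E oppr_ge0.
move=> pos M0 L0; rewrite (ger0_norm pos) !ler_norml => /andP[l1 l2] /andP[r1 rM] /andP[s1 s2] h0 hh.
apply: (@le_trans _ _ (rho + h * (ac_f rho - l * ac_g rho))).
  rewrite -subr_ge0.
  have -> : rho + h * (ac_f rho - l * ac_g rho) - (s + h * (ac_f s - l * ac_g s)) =
    (rho - s) * (1 + h * (1 - (rho ^+ 2 + rho * s + s ^+ 2) + l * (rho + s))).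
    by rewrite /ac_f /ac_g; ring.
  apply: mulr_ge0; first lra.
  have B : - (3 * M ^+ 2 + 2 * L * M) <= 1 - (rho ^+ 2 + rho * s + s ^+ 2) + l * (rho + s).
    have : rho ^+ 2 + rho * s + s ^+ 2 <= 3 * M ^+ 2 by nra.
    have : - (2 * L * M) <= l * (rho + s) by nra.
    lra.
  have : h * - (3 * M ^+ 2 + 2 * L * M) <= h * (1 - (rho ^+ 2 + rho * s + s ^+ 2) + l * (rho + s)).
    by rewrite ler_pM2l.
  lra.
rewrite lerD2l -mulrA ler_pM2l//.
have -> : ac_f rho - l * ac_g rho = (rho - 1) * ((rho + 1) * (l - rho)).
  by rewrite /ac_f /ac_g; ring.
rewrite mulrC ler_wpM2r//; first lra.
have : (rho + 1) * (l - rho) <= (rho + 1) * L by rewrite ler_wpM2l; lra.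
have : (rho + 1) * L <= (M + 1) * L by rewrite ler_wpM2r; lra.
lra.
Qed.

End reaction.

(** * The exact solution *)

Lemma within_continuous_bounded (R : realType) (V : normedModType R) (v : R -> V) (a b : R) :
  a <= b -> {within `[a, b], continuous v} ->
  exists M, forall t, a <= t <= b -> `|v t| <= M.
Proof.
move=> ab cv; have cn : {within `[a, b], continuous (fun t => `|v t|)}.
  by move=> t; apply: cvg_norm; exact: cv.
have [c _ cmax] := EVT_max ab cn.
by exists `|v c| => t tab; apply: cmax; rewrite in_itv.
Qed.

Section time_derivative.
Variables (R : realType) (d : nat) (Omega : set 'rV[R]_d).
Variable bc : boundary_condition R d.
Local Notation X := (state Omega bc).
Variables (T : R) (u u' : R -> X).
Hypothesis du : has_derivative_on T u u'.

Lemma derivative_eps t e : 0 <= t <= T -> 0 < e -> exists2 r, 0 < r &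
  forall s, 0 <= s <= T -> `|s - t| < r ->
    `|u s - u t - (s - t) *: u' t| <= e * `|s - t|.
Proof.
move=> tT e0; move: (du tT) => /cvgrPdist_le/(_ e e0)[r/= r0 Hr].
exists r => // s sT st.
have [->|neq] := eqVneq s t; first by rewrite !subrr scale0r subr0 !normr0 mulr0.
have := Hr s; rewrite /= in_itv/= distrC => /(_ st neq sT).
have st0 : s - t != 0 by rewrite subr_eq0.
move=> H; have -> : u s - u t - (s - t) *: u' t =
    (s - t) *: ((s - t)^-1 *: (u s - u t) - u' t).
  by rewrite scalerBr scalerA divff// scale1r.
by rewrite normrZ mulrC ler_wpM2r// distrC.
Qed.

Lemma has_derivative_continuous : {within `[0, T], continuous u}.
Proof.
apply/subspace_continuousP => t /=; rewrite in_itv/= => tT.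
apply/cvgrPdist_lt => e e0.
have [r r0 Hr] := derivative_eps tT (@ltr01 R).
pose K := `|u' t| + 1 + 1.
have K0 : 0 < K by rewrite /K; have := normr_ge0 (u' t); lra.
exists (Num.min r (e / K)) => /=; first by rewrite lt_min r0 divr_gt0.
move=> s/=; rewrite lt_min => /andP[sr se]; rewrite in_itv/= => sT.
move: sr se; rewrite distrC => sr se.
have := Hr s sT sr; rewrite mul1r => H.
rewrite distrC -(subrK ((s - t) *: u' t) (u s - u t)).
apply: (le_lt_trans (ler_normD _ _)); rewrite normrZ.
move: se; rewrite ltr_pdivlMr// /K => se.
have := normr_ge0 (s - t); have := normr_ge0 (u' t); nra.
Qed.

Lemma has_derivative_right t : 0 <= t < T ->
  h^-1 *: (u (t + h) - u t) @[h --> 0^'+] --> u' t.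
Proof.
move=> /andP[t0 tT]; apply/cvgrPdist_le => e e0.
have tT' : 0 <= t <= T by rewrite t0 ltW.
have [r r0 Hr] := derivative_eps tT' e0.
near=> h.
have h0 : 0 < h by [].
have hr : h < r by near: h; exact: nbhs_right_lt.
have hT : h < T - t by near: h; apply: nbhs_right_lt; rewrite subr_gt0.
have := Hr (t + h); rewrite addrAC subrr add0r (gtr0_norm h0) => /(_ _ hr) H.
have -> : u' t = h^-1 *: (h *: u' t) by rewrite scalerA mulVf ?scale1r// gt_eqF.
rewrite -scalerBr normrZ distrC gtr0_norm ?invr_gt0// mulrC ler_pdivrMr//.
by apply: H; lra.
Unshelve. all: by end_near. Qed.

Lemma time_lipschitz C s t : (forall r, 0 <= r <= T -> `|u' r| <= C) ->
  0 <= s -> s <= t -> t <= T -> `|u t - u s| <= C * (t - s).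
Proof.
move=> uC s0 st tT; rewrite -subr_le0.
pose f r := `|u r - u s| - C * (r - s).
suff : f t <= f s by rewrite /f !subrr normr0 mulr0 subr0.
apply: dini_le => //.
  have cu : {within `[s, t], continuous u}.
    apply: continuous_subspaceW has_derivative_continuous.
    by move=> r/=; rewrite !in_itv/=; lra.
  move=> r; rewrite /f; apply: cvgB.
    by apply: cvg_norm; apply: cvgB; [exact: cu|exact: cvg_cst].
  have : {within `[s, t], continuous (fun r : R => C * (r - s))}.
    apply: continuous_subspaceT => z; apply: cvgMr.
    by apply: cvgB; [exact: cvg_id|exact: cvg_cst].
  exact.
move=> r /andP[sr rt] e e0.
have rT : 0 <= r < T by lra.
move/cvgrPdist_le : (has_derivative_right rT) => /(_ _ e0) dr.
near=> h; have h0 : 0 < h by [].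
have /= hd : `|u' r - h^-1 *: (u (r + h) - u r)| <= e by near: h.
rewrite /f.
have h1 : `|u (r + h) - u r| <= h * (C + e).
  rewrite mulrC -ler_pdivrMr// mulrC -[h^-1]gtr0_norm ?invr_gt0// -normrZ.
  have -> : h^-1 *: (u (r + h) - u r) =
      u' r - (u' r - h^-1 *: (u (r + h) - u r)) by rewrite subKr.
  apply: (le_trans (ler_normB _ _)); apply: lerD => //; apply: uC; lra.
have h2 : `|u (r + h) - u s| <= `|u (r + h) - u r| + `|u r - u s|.
  by rewrite -(subrKA (u r)) ler_normD.
lra.
Unshelve. all: by end_near. Qed.
End time_derivative.

Section exact_solution_theory.
Variables (R : realType) (d : nat) (Omega : set 'rV[R]_d).
Variable bc : boundary_condition R d.
Hypotheses (oO : open Omega) (bO : bounded_set Omega).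
Local Notation X := (state Omega bc).
Variables (eps : R) (heps : 0 < eps) (S : R -> X -> X).
Hypotheses (hS : contraction_semigroup S)
  (hSlap : generates (@laplacian R d Omega bc) S).
Variables (T : R) (u0 : X) (u : R -> X).
Hypothesis hu : exact_solution eps T u0 u.
Local Notation P := (etd_semigroup S eps).

Let eps2 : 0 < eps ^+ 2. Proof. by rewrite exprn_gt0. Qed.

Lemma etd_contraction kappa : 0 <= kappa -> contraction_semigroup (P kappa).
Proof. exact: damped_contraction_semigroup. Qed.

(** u' is the sum of eps^2 Delta u and the reaction, while P kappa h (u t) - u t
has right derivative eps^2 Delta u - kappa u: the unbounded operator cancels. *)
Lemma exact_solution_right_derivative kappa t : 0 <= kappa -> 0 < t < T ->
  h^-1 *: (u (t + h) - P kappa h (u t)) @[h --> 0^'+] --> nonlinearity kappa (u t).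
Proof.
move=> k0 /andP[t0 tT]; have [_ [u' [du _ ueq]]] := hu.
have [w uw u'E] := ueq t ltac:(lra).
have dP := damped_generator eps2 ((hSlap (u t) w).1 uw) (kappa := kappa).
have dr := has_derivative_right du (t := t) ltac:(lra).
have -> : nonlinearity kappa (u t) = u' t - (eps ^+ 2 *: w - kappa *: u t).
  rewrite u'E /nonlinearity; set F := state_comp _ _; set G := lambda _ *: _.
  set W := eps ^+ 2 *: w; set K := kappa *: u t.
  by rewrite opprB [RHS]addrC -[W + F - G]addrA [RHS]addrA subrK addrA.
rewrite [X in X @ _ --> _](_ : _ = fun h : R => h^-1 *: (u (t + h) - u t) -
   h^-1 *: (P kappa h (u t) - u t)); last first.
  by apply/funext => h; rewrite -scalerBr opprB addrA subrK.
exact: cvgB dr dP.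
Qed.

(** With K = (M + 1) L as in [reaction_step], the function
exp (- K t) (max (1, |u t|) - 1) has nonpositive right Dini derivative and
vanishes at 0.  M and L are a priori bounds for |u| and |lambda| on [0, T]; the
second one uses the lower bound of the mass of g(u). *)
Lemma exact_solution_max_principle gamma : 0 < T -> `|u0| <= 1 -> 0 < gamma ->
  (forall t, 0 <= t <= T -> gamma <= mass Omega (fun x => ac_g (u t x))) ->
  forall t, 0 <= t <= T -> `|u t| <= 1.
Proof.
move=> T0 u01 g0 gu t /andP[t0 tT].
have [uu0 [u' [du _ _]]] := hu.
have cu := has_derivative_continuous du.
have [M0 uM0] := within_continuous_bounded (ltW T0) cu.
pose M := Num.max 1 M0.
have M1 : 1 <= M by rewrite le_max lexx.
have uM r : 0 <= r <= T -> `|u r| <= M by move=> /uM0 H; rewrite le_max H orbT.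
pose L := volume Omega * (M + M ^+ 3) / gamma.
have V0 := volume_ge0 Omega.
have L0 : 0 <= L.
  by rewrite /L divr_ge0 ?mulr_ge0 ?addr_ge0 ?exprn_ge0 ?(ltW g0)//; lra.
have uL r : 0 <= r <= T -> `|lambda (u r)| <= L.
  move=> rT; have gr := gu r rT.
  rewrite /lambda normrM normfV /L ler_pM ?invr_ge0//.
    rewrite (mass_comp (@continuous_ac_f R)); apply: (le_trans (normr_mass oO bO _)).
    rewrite ler_wpM2l//; apply: sup_norm_le => [|x Ox].
      by rewrite addr_ge0 ?exprn_ge0//; lra.
    rewrite state_compE// /ac_f; apply: (le_trans (ler_normB _ _)).
    have urx : `|u r x| <= M by rewrite (le_trans (sup_norm_ub _ _))// uM.
    by rewrite lerD// normrX lerXn2r// nnegrE; lra.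
  rewrite lef_pV2 ?posrE// ?(le_trans gr (ler_norm _))//.
  by rewrite normr_gt0 gt_eqF// (lt_le_trans g0).
pose K := (M + 1) * L.
have K0 : 0 <= K by rewrite mulr_ge0//; lra.
pose m r := Num.max 1 `|u r|.
pose z r := expR (- (K * r)) * (m r - 1).
have m0 : m 0 = 1 by rewrite /m uu0; apply/max_idPl.
suff : z t <= z 0.
  rewrite /z m0 subrr mulr0 pmulr_rle0 ?expR_gt0// subr_le0 ge_max.
  by case/andP.
apply: dini_le => //.
  have cut : {within `[0, t], continuous u}.
    apply: continuous_subspaceW cu => r /=; rewrite !in_itv/=; lra.
  move=> r; rewrite /z; apply: cvgM.
    have : {within `[0, t], continuous (fun r : R => expR (- (K * r)))}.
      apply: continuous_subspaceT => y.
      apply: (@continuous_comp _ _ _ (fun r => - (K * r)) expR).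
        by apply: cvgN; apply: cvgMr; exact: cvg_id.
      exact: continuous_expR.
    exact.
  apply: cvgB; last exact: cvg_cst.
  have : {within `[0, t], continuous ((cst 1 : R -> R) \max (fun r => `|u r|))}.
    move=> x; apply: continuous_max; first exact: cvg_cst.
    by apply: cvg_norm; exact: cut.
  exact.
move=> r /andP[r0 rt] e e0; have e2 : 0 < e / 2 by rewrite divr_gt0.
have rT : 0 <= r <= T by lra.
(* undamped semigroup: kappa = 0 leaves the bare reaction term *)
have := @exact_solution_right_derivative 0 r (lexx _) ltac:(lra).
set N0 := nonlinearity 0 (u r).
move=> /cvgrPdist_le/(_ _ e2) dr.
have P0 := etd_contraction (lexx (0 : R)).
move/cvgrPdist_le : (@semigroup_continuous _ _ _ P0 N0) => /(_ _ e2) PN.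
have B0 : 0 < 3 * M ^+ 2 + 2 * L * M by nra.
near=> h; have h0 : 0 < h by [].
have /= h1 : `|N0 - h^-1 *: (u (r + h) - P 0 h (u r))| <= e / 2 by near: h.
have /= h2 : `|N0 - P 0 h N0| <= e / 2 by near: h.
have h3 : h * (3 * M ^+ 2 + 2 * L * M) <= 1.
  rewrite -ler_pdivlMr// mul1r; near: h.
  by apply: nbhs_right_le; rewrite invr_gt0; exact: B0.
have mr : 1 <= m r <= M by rewrite /m le_max lexx ge_max M1 uM.
have hKm : 0 <= h * K * (m r - 1).
  by apply: mulr_ge0; [apply: mulr_ge0 => //; exact: ltW|lra].
have step : `|u r + h *: N0| <= m r + h * K * (m r - 1).
  apply: sup_norm_le => [|x Ox]; first lra.
  rewrite -[(u r + h *: N0) x]/(u r x + h * N0 x) /N0 nonlinearityE// mul0r add0r.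
  apply: (reaction_step (M := M)) => //; first lra.
  - exact: uL.
  - by rewrite /m le_max sup_norm_ub orbT.
have main : `|u (r + h)| <= m r + h * K * (m r - 1) + e * h.
  set q := h^-1 *: (u (r + h) - P 0 h (u r)) in h1.
  have -> : u (r + h) = P 0 h (u r + h *: N0) + h *: ((N0 - P 0 h N0) - (N0 - q)).
    have -> : (N0 - P 0 h N0) - (N0 - q) = q - P 0 h N0.
      by rewrite opprB [LHS]addrC addrA subrK.
    have hq : h *: q = u (r + h) - P 0 h (u r) by rewrite scalerA divff ?scale1r// gt_eqF.
    rewrite (addrC (u r)) (semigroup_linear P0 (ltW h0)) scalerBr hq.
    by rewrite [RHS]addrC [RHS]addrA subrK subrK.
  apply: (le_trans (ler_normD _ _)); apply: lerD.
    exact: le_trans (semigroup_contraction P0 _ (ltW h0)) step.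
  rewrite normrZ gtr0_norm// mulrC ler_wpM2r// ?(ltW h0)//.
  by apply: (le_trans (ler_normB _ _)); lra.
have mh : m (r + h) <= m r + h * K * (m r - 1) + e * h.
  rewrite {1}/m ge_max main andbT.
  have := mulr_ge0 (ltW e0) (ltW h0); lra.
rewrite /z (_ : - (K * (r + h)) = - (K * r) + - (K * h)); last by ring.
rewrite expRD.
have E0 := expR_gt0 (- (K * r)).
have E1 : expR (- (K * r)) <= 1 by rewrite -expR0 ler_expR oppr_le0 mulr_ge0// ltW.
have F0 := expR_gt0 (- (K * h)).
have F1 : expR (- (K * h)) <= 1 by rewrite -expR0 ler_expR oppr_le0 mulr_ge0// ltW.
have F2 : expR (- (K * h)) * (1 + K * h) <= 1.
  have := expR_ge1Dx (K * h); rewrite expRN -ler_pdivlMl ?invr_gt0 ?expR_gt0//.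
  by rewrite invrK mulr1.
move: (expR (- (K * r))) (expR (- (K * h))) E0 E1 F0 F1 F2 => a b a0 a1 b0 b1 b2.
have : b * (m (r + h) - 1) <= (m r - 1) + e * h.
  apply: (@le_trans _ _ (b * ((m r - 1) * (1 + K * h) + e * h))).
    rewrite ler_pM2l//.
    have -> : (m r - 1) * (1 + K * h) = (m r - 1) + h * K * (m r - 1) by ring.
    by move: mh; lra.
  have : b * (1 + K * h) * (m r - 1) <= 1 * (m r - 1) by rewrite ler_wpM2r//; lra.
  have : b * (e * h) <= 1 * (e * h) by rewrite ler_wpM2r// mulr_ge0// ltW.
  lra.
have eh : 0 < e * h by rewrite mulr_gt0.
move=> H; have : a * (b * (m (r + h) - 1)) <= a * ((m r - 1) + e * h) by rewrite ler_pM2l.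
have : a * (e * h) <= 1 * (e * h) by rewrite ler_wpM2r// ltW.
lra.
Unshelve. all: by end_near. Qed.
End exact_solution_theory.

(** * The ETD1 scheme *)

Section etd_step.
Variables (R : realType) (d : nat) (Omega : set 'rV[R]_d).
Variable bc : boundary_condition R d.
Hypotheses (oO : open Omega) (bO : bounded_set Omega).
Local Notation X := (state Omega bc).
Variables (eps : R) (heps : 0 < eps) (S : R -> X -> X).
Hypothesis hS : contraction_semigroup S.
Local Notation P := (etd_semigroup S eps).
Variables (kappa tau : R).
Hypotheses (k0 : 0 < kappa) (tau0 : 0 <= tau).

Lemma etd_duhamel_bound (phi G : R -> X) (v N0 : X) (E D : R) x :
  {within `[0, tau], continuous phi} ->
  (forall s, 0 < s < tau ->
    h^-1 *: (phi (s + h) - P kappa h (phi s)) @[h --> 0^'+] --> G s) ->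
  (forall s, 0 < s < tau -> `|G s - N0| <= D) ->
  `|phi 0 - v| <= E ->
  `|phi tau x - (P kappa tau v x +
     \int[lebesgue_measure]_(s in `[0, tau]) P kappa (tau - s) N0 x)|
  <= expR (- (kappa * tau)) * E + (1 - expR (- (kappa * tau))) / kappa * D.
Proof.
move=> cphi dphi GN phiv.
have eps2 : 0 < eps ^+ 2 by rewrite exprn_gt0.
have cP := etd_contraction heps hS (ltW k0).
have decay t w : 0 <= t -> `|P kappa t w| <= expR (- (kappa * t)) * `|w|.
  exact: damped_decay.
have := @duhamel_bound _ _ _ cP kappa k0 decay (fun w => w x) tau phi G N0 D.
move=> /(_ (fun _ _ => erefl) (fun _ _ => erefl) (fun w => sup_norm_ub w x) tau0 cphi dphi GN).
set I := Rintegral _ _ _ => B.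
have -> : phi tau x - (P kappa tau v x + I) =
  P kappa tau (phi 0 - v) x + (phi tau x - P kappa tau (phi 0) x - I).
  by rewrite (semigroupB cP)// state_subE; ring.
apply: (le_trans (ler_normD _ _)); apply: lerD B.
apply: (le_trans (sup_norm_ub _ x)); apply: (le_trans (decay _ _ tau0)).
by rewrite ler_wpM2l// expR_ge0.
Qed.

(** The estimate [etd_duhamel_bound] for the zero function bounds the new iterate
by exp (- kappa tau) * 1 + (1 - exp (- kappa tau)) / kappa * kappa = 1. *)
Lemma etd1_max_principle (u0 : X) (U : nat -> X) n : 4 <= kappa ->
  etd1 S eps kappa tau u0 U -> `|U n| <= 1 -> `|U n.+1| <= 1.
Proof.
move=> k4 [_ Ustep] U1; apply: sup_norm_le => // x Ox; rewrite Ustep//.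
have N1 := normr_nonlinearity oO bO k4 U1.
have cP := etd_contraction heps hS (ltW k0).
have : `|(0 : X) x - (P kappa tau (U n) x +
     \int[lebesgue_measure]_(s in `[0, tau])
       P kappa (tau - s) (nonlinearity kappa (U n)) x)|
  <= expR (- (kappa * tau)) * 1 + (1 - expR (- (kappa * tau))) / kappa * kappa.
  apply: (@etd_duhamel_bound (fun=> 0) (fun=> 0)).
  - by move=> s; exact: cvg_cst.
  - move=> s s0; apply/cvgrPdist_le => e e0; near=> h.
    by rewrite (semigroup_zero cP)// subrr scaler0 subrr normr0 ltW.
  - by move=> s _; rewrite sub0r normrN.
  - by rewrite sub0r normrN.
have -> : expR (- (kappa * tau)) * 1 + (1 - expR (- (kappa * tau))) / kappa * kappa = 1.
  by field; rewrite gt_eqF.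
by rewrite -[(0 : X) x]/(0 : R) sub0r normrN.
Unshelve. all: by end_near. Qed.

End etd_step.

(** With a = 1 - exp (- kappa tau) <= kappa tau the left-hand side is
(1 + (Cs - 1) a) E + A (Cs - 1) a, so the bound A (X - 1) is preserved when X is
multiplied by exp ((Cs - 1) kappa tau) >= 1 + (Cs - 1) a.  A (Cs - 1) / Cs plays
the role of the one-step increment C tau of the exact solution. *)
Lemma gronwall_step (R : realType) (kappa tau Cs A E X : R) :
  0 < kappa -> 0 <= tau -> 1 < Cs -> 0 <= A -> 0 <= X ->
  let a := 1 - expR (- (kappa * tau)) in
  E <= A * (X - 1) ->
  expR (- (kappa * tau)) * E +
    a / kappa * (Cs * kappa * (A * (Cs - 1) / Cs + E)) <=
  A * (expR ((Cs - 1) * kappa * tau) * X - 1).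
Proof.
move=> k0 t0 Cs1 A0 X0 a EA.
have b1 := expR_ge1Dx (- (kappa * tau)).
have kt : 0 <= kappa * tau by rewrite mulr_ge0// ltW.
have a0 : 0 <= a by rewrite subr_ge0 -expR0 ler_expR oppr_le0.
have -> : expR (- (kappa * tau)) = 1 - a by rewrite /a subKr.
have -> : (1 - a) * E + a / kappa * (Cs * kappa * (A * (Cs - 1) / Cs + E)) =
    (1 + (Cs - 1) * a) * E + A * ((Cs - 1) * a).
  by field; rewrite !gt_eqF//; lra.
have p0 : 0 <= (Cs - 1) * a by rewrite mulr_ge0// subr_ge0 ltW.
have pq : 1 + (Cs - 1) * a <= expR ((Cs - 1) * kappa * tau).
  apply: le_trans (expR_ge1Dx _); rewrite lerD2l -mulrA ler_pM2l ?subr_gt0//.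
  by rewrite /a; lra.
move: p0 pq; move: ((Cs - 1) * a) (expR _) => p q p0 pq.
have h1 : (1 + p) * E <= (1 + p) * (A * (X - 1)) by rewrite ler_wpM2l//; lra.
have h2 : A * ((1 + p) * X) <= A * (q * X) by rewrite ler_wpM2l// ler_wpM2r.
lra.
Qed.

Theorem theorem3 (R : realType) (d : nat) (hd : d = 2%N \/ d = 3%N)
  (Omega : set 'rV[R]_d) (hOmega : lipschitz_domain Omega)
  (bc : boundary_condition R d) (hbc : compatible bc Omega)
  (eps : R) (heps : 0 < eps)
  (S : R -> state Omega bc -> state Omega bc)
  (hS : contraction_semigroup S)
  (hSlap : generates (@laplacian R d Omega bc) S)
  (T : R) (hT : 0 < T)
  (u0 : state Omega bc) (hu0 : `|u0| <= 1)
  (hM0 : `|mass Omega u0| <> volume Omega)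
  (u : R -> state Omega bc) (hu : exact_solution eps T u0 u) :
  exists C : R, 0 < C /\
  forall (kappa gamma_u gamma_d tau : R) (U : nat -> state Omega bc),
    kappa_min R <= kappa ->
    0 < gamma_u ->
    (forall t, 0 <= t <= T ->
      gamma_u <= mass Omega (fun x => ac_g (u t x))) ->
    0 < tau ->
    etd1 S eps kappa tau u0 U ->
    0 < gamma_d ->
    (forall n : nat, n%:R * tau <= T ->
      gamma_d <= mass Omega (fun x => ac_g (U n x))) ->
    let gamma := Num.min gamma_u gamma_d in
    let Cs := Cstar Omega gamma in
    forall n : nat, n%:R * tau <= T ->
      `|u (n%:R * tau) - U n| <=
        Cs / (Cs - 1) * C * expR ((Cs - 1) * kappa * (n%:R * tau)) * tau.
Proof.
have [oO _ bO _] := hOmega.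
have [uu0 [u' [du cu' _]]] := hu.
have [M uM] := within_continuous_bounded (ltW hT) cu'.
(* C must be positive even when u is constant in time *)
pose C := `|M| + 1.
have C0 : 0 < C by rewrite /C; have := normr_ge0 M; lra.
have uC r : 0 <= r <= T -> `|u' r| <= C.
  by move=> /uM; rewrite /C; have := ler_norm M; lra.
exists C; split=> // kappa gamma_u gamma_d tau U; rewrite kappa_minE => k4 gu0 gu.
move=> tau0 hU gd0 gd gamma Cs.
have k0 : 0 < kappa by lra.
have g0 : 0 < gamma by rewrite lt_min gu0.
have u1 := exact_solution_max_principle oO bO heps hS hSlap hu hT hu0 gu0 gu.
have Cs1 : 1 < Cs.
  have V0 := volume_ge0 Omega.
  have : 0 <= Cgamma Omega gamma.
    by rewrite addr_ge0// divr_ge0 ?mulr_ge0 ?exprn_ge0// ltW.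
  by rewrite /Cs /Cstar; lra.
pose A := Cs / (Cs - 1) * C * tau.
have A0 : 0 <= A by rewrite !mulr_ge0 ?invr_ge0//; lra.
suff main n : n%:R * tau <= T -> `|U n| <= 1 /\
    `|u (n%:R * tau) - U n| <= A * (expR ((Cs - 1) * kappa * (n%:R * tau)) - 1).
  move=> n /main[_ H]; apply: (le_trans H).
  rewrite -/A [leRHS]mulrAC -/A; lra.
elim: n => [_|n IHn nT].
  have [U0 _] := hU.
  by rewrite mul0r uu0 U0 mulr0 expR0 !subrr normr0 mulr0.
have tn0 : 0 <= n%:R * tau by rewrite mulr_ge0// ltW.
have nS : n.+1%:R * tau = n%:R * tau + tau by rewrite -natr1 mulrDl mul1r.
rewrite nS in nT *.
have [U1 En] := IHn ltac:(lra).
split; first exact: (etd1_max_principle oO bO heps hS k0 (ltW tau0) k4 hU).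
set E := `|u (n%:R * tau) - U n| in En.
rewrite (_ : (Cs - 1) * kappa * (n%:R * tau + tau) =
  (Cs - 1) * kappa * tau + (Cs - 1) * kappa * (n%:R * tau)); last by ring.
rewrite expRD.
apply: le_trans (gronwall_step k0 (ltW tau0) Cs1 A0 (expR_ge0 _) En).
have AC : A * (Cs - 1) / Cs = C * tau.
  by rewrite /A; field; rewrite !gt_eqF//; lra.
rewrite AC; apply: sup_norm_le => [|x Ox].
  have E0 : 0 <= E by exact: normr_ge0.
  rewrite addr_ge0// mulr_ge0 ?expR_ge0//.
    rewrite divr_ge0 ?(ltW k0)// subr_ge0 -expR0 ler_expR oppr_le0.
    by rewrite mulr_ge0// ltW.
  rewrite mulr_ge0 ?addr_ge0 ?mulr_ge0 ?(ltW tau0) ?(ltW k0) ?(ltW C0)//; lra.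
rewrite state_subE (hU.2 n x Ox).
pose phi s := u (n%:R * tau + s).
rewrite -[u (n%:R * tau + tau)]/(phi tau).
apply: (etd_duhamel_bound heps hS k0 (ltW tau0) (phi := phi)
  (G := fun s => nonlinearity kappa (phi s))).
- apply/subspace_continuousP => t /=; rewrite in_itv/= => tt.
  apply/cvgrPdist_lt => e e0; exists (e / C) => /=; first by rewrite divr_gt0.
  move=> s /=; rewrite ltr_pdivlMr// mulrC in_itv/= => st ss; apply: le_lt_trans st.
  rewrite /phi; have [ts|/ltW ts] := leP t s.
    rewrite distrC (distrC t) ger0_norm ?subr_ge0//.
    apply: (le_trans (time_lipschitz du uC _ _ _)); [lra..|].
    by rewrite opprD addrACA subrr add0r.
  rewrite ger0_norm ?subr_ge0//.
  apply: (le_trans (time_lipschitz du uC _ _ _)); [lra..|].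
  by rewrite opprD addrACA subrr add0r.
- move=> s /andP[s0 st]; rewrite /phi.
  under eq_fun do rewrite addrA.
  by apply: (exact_solution_right_derivative heps hSlap hu); lra.
- move=> s /andP[s0 st].
  apply: (le_trans (nonlinearity_lipschitz oO bO (gamma := gamma) k4 _ _ _ _ _)) => //.
  + by rewrite /phi; apply: u1; lra.
  + rewrite ge_min; apply/orP; left; rewrite /phi; apply: gu; lra.
  + rewrite ge_min; apply/orP; right; apply: gd; lra.
  + apply: ler_wpM2l; first by rewrite mulr_ge0 ?(ltW k0)// ltW// (lt_trans ltr01).
    have -> : phi s - U n = (phi s - u (n%:R * tau)) + (u (n%:R * tau) - U n).
      by rewrite addrA subrK.
    rewrite (le_trans (ler_normD _ _))// lerD// /phi.
    apply: (le_trans (time_lipschitz du uC _ _ _)); [lra..|].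
    by rewrite addrAC subrr add0r ler_pM2l// ltW.
- by rewrite /phi addr0.
Qed.
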